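(* Let $\Gamma$ be a trivalent graph equipped with a holonomy $\psi:H\to\mathrm{SL}_2(\mathbb{C})$, and let $G=\mathrm{SU}(2)$ with Haar probability measure. For admissible colorings $c$ put $$[\Gamma,c,\psi]=\frac{\langle\Gamma,c,\psi\rangle^2}{\prod_{v:(e_1,e_2,e_3)}\langle c_{e_1},c_{e_2},c_{e_3}\rangle},$$ where the product is over vertices $v$, with incident edges $e_1,e_2,e_3$, and let $W(\Gamma,\psi)=\sum_{c\text{ admissible}}[\Gamma,c,\psi]\,Y^c$ with $Y^c=\prod_{e\in E}Y_e^{c_e}$. Then in $R_Y=\mathbb{C}[[Y_e,e\in E]]$ $$W(\Gamma,\psi)=\int_{G^V}\frac{\mathrm{d}g}{\prod_{e}\det\big(\psi_{h_2}g_w\psi_{h_2}^{-1}-\psi_{h_1}g_v\psi_{h_1}^{-1}Y_e\big)},$$ where the product is over edges $e$, each arbitrarily oriented from an end $v$ to an end $w$, with $h_1=(e,v)$ and $h_2=(e,w)$ its half-edges at $v$ and $w$.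
   Context: **Graphs.** $\Gamma$ is a finite connected trivalent graph with at least one vertex, loops and multiple edges allowed, with vertex set $V$, edge set $E$, and set $H$ of half-edges (each edge is divided into two half-edges; a half-edge is written $(e,v)$, $v$ being the end of $e$ it touches). At each vertex the three half-edges carry a cyclic order. **Colorings.** An admissible coloring is a map $c:E\to\mathbb{N}=\{0,1,2,\dots\}$ such that at every vertex, with incident edges $i,j,k$, $c_i+c_j+c_k$ is even and $c_i\le c_j+c_k$, $c_j\le c_i+c_k$, $c_k\le c_i+c_j$. **Evaluation.** Fix a total order on $H$ for which the three half-edges at each vertex are consecutive and, listed increasingly as $v_1<v_2<v_3$, follow the cyclic order at $v$. For an edge $e$ let $e_1<e_2$ be its half-edges. Two edges $e,e'$ cross if $e_1<e'_1<e_2<e'_2$ or $e'_1<e_1<e'_2<e_2$. For $\psi:H\to\mathrm{SL}_2(\mathbb{C})$ and $c$ admissible, $$\langle\Gamma,c,\psi\rangle=(-1)^{\sum_{\{e,e'\}\text{ crossing}}c_ec_{e'}}\prod_{e\in E}\frac{1}{(c_e!)^2}\Big(\frac{\partial}{\partial z_{e_1}}\frac{\partial}{\partial w_{e_2}}-\frac{\partial}{\partial z_{e_2}}\frac{\partial}{\partial w_{e_1}}\Big)^{c_e}\ \prod_{v\in V}\epsilon_v,$$ where $(z_h,w_h)$, $h\in H$, are independent variables and $\epsilon_v$ is the polynomial $$(z_{v_2}w_{v_1}-z_{v_1}w_{v_2})^{\frac{c_{v_1}+c_{v_2}-c_{v_3}}2}(z_{v_3}w_{v_2}-z_{v_2}w_{v_3})^{\frac{c_{v_2}+c_{v_3}-c_{v_1}}2}(z_{v_3}w_{v_1}-z_{v_1}w_{v_3})^{\frac{c_{v_1}+c_{v_3}-c_{v_2}}2}$$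 in which each $(z_h,w_h)$ has been replaced by $\psi_h^{-1}(z_h,w_h)$ (column vectors); $c_{v_i}$ is the color of the edge containing $v_i$. (This is independent of the chosen order.) **Theta values.** For a triple $(a,b,c)$ satisfying the admissibility conditions, $$\langle a,b,c\rangle=\frac{(\frac{a+b+c}{2}+1)!\,(\frac{a+b-c}{2})!\,(\frac{a-b+c}{2})!\,(\frac{-a+b+c}{2})!}{a!\,b!\,c!},$$ which is the absolute value of the evaluation of the theta graph with edges colored $a,b,c$ and trivial holonomy. **Integral.** The integrand is expanded as a formal power series in the $Y_e$ (each determinant has constant term $1$) and integrated coefficientwise over $(g_v)_{v\in V}\in G^V$. *)

(* Defs.v *)
From HB Require Import structures.
From mathcomp Require Import all_boot all_order all_algebra.
From mathcomp Require Import sesquilinear spectral complex.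
(* mpoly's notations clash with those of mathcomp-analysis *)
From mathcomp Require Import -(notations) mpoly.
From mathcomp Require Import all_classical all_reals all_analysis.

Set Implicit Arguments.
Unset Strict Implicit.
Unset Printing Implicit Defensive.

Import Order.TTheory GRing.Theory Num.Theory.
Import numFieldNormedType.Exports.

Local Open Scope classical_set_scope.
Local Open Scope ring_scope.

(* A series is the function sending a multi-exponent m to the coefficient
   of X^m. *)
Definition fps (n : nat) (K : fieldType) : Type := multinom n -> K.

Section FPS.
Variables (n : nat) (K : fieldType).
Local Notation fps := (fps n K).
Implicit Types (F G H : fps) (m : multinom n).

HB.instance Definition _ := gen_eqMixin fps.
HB.instance Definition _ := gen_choiceMixin fps.

Definition fps_add F G : fps := fun m => F m + G m.
Definition fps_opp F : fps := fun m => - F m.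
Definition fps0 : fps := fun=> 0.

Fact fps_addA : associative fps_add.
Proof. by move=> F G H; apply/funext => m; rewrite /fps_add addrA. Qed.
Fact fps_addC : commutative fps_add.
Proof. by move=> F G; apply/funext => m; rewrite /fps_add addrC. Qed.
Fact fps_add0 : left_id fps0 fps_add.
Proof. by move=> F; apply/funext => m; rewrite /fps_add /fps0 add0r. Qed.
Fact fps_addN : left_inverse fps0 fps_opp fps_add.
Proof. by move=> F; apply/funext => m; rewrite /fps_add /fps_opp addNr. Qed.

HB.instance Definition _ :=
  GRing.isZmodule.Build fps fps_addA fps_addC fps_add0 fps_addN.

Definition fpsC (a : K) : fps := fun m => a *+ (m == @mnm0 n).
Definition fpsX (i : 'I_n) : fps := fun m => (m == mnm1 i)%:R.

(* Cauchy product; the type of k only makes the sum finite, since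
   k.1 + k.2 = m already bounds the degrees of k.1 and k.2. *)
Definition fps_mul F G : fps := fun m =>
  \sum_(k : bmultinom n (mdeg m).+1 * bmultinom n (mdeg m).+1
          | m == mnm_add k.1 k.2) F k.1 * G k.2.

Definition fps_trunc (N : nat) F : mpoly n K :=
  \sum_(k : bmultinom n N) F k *: mpolyX K k.

Fact fps_truncE N F m : (mdeg m < N)%N -> mcoeff m (fps_trunc N F) = F m.
Proof. exact: mcoeff_mpoly. Qed.

Fact fps_mulE N F G m (p q : mpoly n K) : (mdeg m < N)%N ->
  (forall k, (mdeg k < N)%N -> mcoeff k p = F k) ->
  (forall k, (mdeg k < N)%N -> mcoeff k q = G k) ->
  fps_mul F G m = mcoeff m (p * q).
Proof.
move=> mN pF qG; rewrite mcoeffM; apply: eq_bigr => k _.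
by rewrite pF ?qG ?(leq_trans (bmdeg _)).
Qed.

Fact fps_mulA : associative fps_mul.
Proof.
move=> F G H; apply/funext => m; pose T := fps_trunc (mdeg m).+1.
have TE E k : (mdeg k < (mdeg m).+1)%N -> mcoeff k (T E) = E k.
  exact: fps_truncE.
have TM E E' k : (mdeg k < (mdeg m).+1)%N ->
    mcoeff k (T E * T E') = fps_mul E E' k.
  by move=> km; rewrite -(@fps_mulE (mdeg m).+1 E E')// => j; apply: TE.
rewrite (@fps_mulE (mdeg m).+1 _ _ m (T F) (T G * T H))//; [|exact: TE|exact: TM].
rewrite (@fps_mulE (mdeg m).+1 _ _ m (T F * T G) (T H))//; [|exact: TM|exact: TE].
by rewrite mulrA.
Qed.

Fact fps_mulC : commutative fps_mul.
Proof.
move=> F G; apply/funext => m; pose T := fps_trunc (mdeg m).+1.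
have TE E k : (mdeg k < (mdeg m).+1)%N -> mcoeff k (T E) = E k.
  exact: fps_truncE.
rewrite (@fps_mulE (mdeg m).+1 _ _ m (T F) (T G))//; [|exact: TE|exact: TE].
rewrite (@fps_mulE (mdeg m).+1 _ _ m (T G) (T F))//; [|exact: TE|exact: TE].
by rewrite mulrC.
Qed.

Fact fps_mul1 : left_id (fpsC 1) fps_mul.
Proof.
move=> F; apply/funext => m; pose T := fps_trunc (mdeg m).+1.
rewrite (@fps_mulE (mdeg m).+1 _ _ m 1 (T F))//; last exact: fps_truncE.
  by rewrite mul1r fps_truncE.
by move=> k _; rewrite mcoeff1.
Qed.

Fact fps_mulD : left_distributive fps_mul fps_add.
Proof.
move=> F G H; apply/funext => m; rewrite /fps_mul /fps_add -big_split/=.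
by apply: eq_bigr => k _; rewrite mulrDl.
Qed.

Fact fps_oner_neq0 : fpsC 1 != 0.
Proof.
apply/eqP => /(congr1 (fun F : fps => F (@mnm0 n))).
by rewrite /fpsC eqxx mulr1n; apply/eqP/oner_neq0.
Qed.

HB.instance Definition _ := GRing.Zmodule_isComNzRing.Build fps
  fps_mulA fps_mulC fps_mul1 fps_mulD fps_oner_neq0.

Definition fps_unit : {pred fps} := fun F => F (@mnm0 n) != 0.

(* If F = a (1 - u) with a = F(0) invertible, then 1/F = a^-1 * sum_k u^k,
   and u^k has no coefficient in degree < k. *)
Definition fps_inv F : fps :=
  if fps_unit F then
    fun m => let a := F (@mnm0 n) in
      (fpsC a^-1 * \sum_(k < (mdeg m).+1) (1 - fpsC a^-1 * F) ^+ k) m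
  else F.

Fact fps_mul_mnm0 F G : (F * G) (@mnm0 n) = F (@mnm0 n) * G (@mnm0 n).
Proof.
rewrite -[LHS]/(fps_mul F G _) (@fps_mulE 1 _ _ _ (fps_trunc 1 F) (fps_trunc 1 G)) ?mdeg0//;
  try exact: fps_truncE.
by rewrite (mcoeff0_is_multiplicative _ _).1 !fps_truncE ?mdeg0.
Qed.

Fact fps_exp_low F k m : F (@mnm0 n) = 0 -> (mdeg m < k)%N -> (F ^+ k) m = 0.
Proof.
move=> F0; elim: k m => // k IH m mk; rewrite exprS.
rewrite /GRing.mul/= /fps_mul big1// => -[k1 k2]/= /eqP mE.
have [k10|k10] := eqVneq (k1 : multinom n) (@mnm0 n).
  by rewrite k10 F0 mul0r.
rewrite IH ?mulr0//.
have dE : mdeg m = (mdeg k1 + mdeg k2)%N by rewrite -mdegD -mE.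
rewrite dE ltnS in mk; apply: leq_trans mk.
by rewrite -[ltnLHS]add0n ltn_add2r lt0n mdeg_eq0.
Qed.

Fact fps_mulVx : {in fps_unit, left_inverse 1 fps_inv *%R}.
Proof.
move=> F; rewrite unfold_in => uF; apply/funext => m.
pose b := fpsC (F (@mnm0 n))^-1; pose u := 1 - b * F.
pose S := \sum_(k < (mdeg m).+1) u ^+ k.
have u0 : u (@mnm0 n) = 0.
  rewrite {1}/u /GRing.add/= /fps_add /GRing.opp/= /fps_opp.
  by rewrite fps_mul_mnm0 {1}/GRing.one/= /b /fpsC eqxx !mulr1n mulVf ?subrr.
have SE k : (mdeg k < (mdeg m).+1)%N -> fps_inv F k = (b * S) k.
  move=> km; rewrite /fps_inv ifT// -/b -/u /S.
  rewrite (_ : \sum_(_ < (mdeg m).+1) _ =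
     \sum_(i < (mdeg k).+1) u ^+ i +
     u ^+ (mdeg k).+1 * \sum_(i < mdeg m - mdeg k) u ^+ i); last first.
    rewrite -(big_mkord xpredT (fun i => u ^+ i)).
    rewrite (big_cat_nat _ (n := (mdeg k).+1))//= big_mkord; congr (_ + _).
    rewrite -{1}[(mdeg k).+1]add0n big_addn subSS big_mkord mulr_sumr.
    by apply: eq_bigr => i _; rewrite addnC exprD.
  rewrite mulrDr {2}/GRing.add/= /fps_add mulrCA.
  rewrite [X in _ = _ + X](_ : _ = 0) ?addr0//.
  rewrite {1}/GRing.mul/= /fps_mul big1// => -[k1 k2]/= /eqP kE.
  have dE : mdeg k = (mdeg k1 + mdeg k2)%N by rewrite -mdegD -kE.
  by rewrite fps_exp_low ?mul0r// ltnS; apply: leq_trans (leq_addr _ _) (eq_leq (esym dE)).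
have -> : (fps_inv F * F) m = (b * S * F) m.
  rewrite /GRing.mul/= /fps_mul; apply: eq_bigr => k _.
  by rewrite SE ?bmdeg.
have -> : b * S * F = 1 - u ^+ (mdeg m).+1.
  rewrite mulrAC -[RHS]opprB subrX1 -mulNr; congr (_ * _).
  by rewrite /u opprB subKr.
rewrite {1}/GRing.add/= /fps_add {1}/GRing.opp/= /fps_opp.
by rewrite fps_exp_low// subr0.
Qed.

Fact fps_unitPl F G : G * F = 1 -> fps_unit F.
Proof.
move=> /(congr1 (fun F : fps => F (@mnm0 n))).
rewrite fps_mul_mnm0 /GRing.one/= /fpsC eqxx mulr1n /fps_unit => GF.
by apply/eqP => F0; move: GF => /eqP; rewrite F0 mulr0 eq_sym oner_eq0.
Qed.

Fact fps_inv_out : {in [predC fps_unit], fps_inv =1 id}.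
Proof. by move=> F nuF; rewrite /fps_inv ifF//; apply/negbTE. Qed.

HB.instance Definition _ := GRing.ComNzRing_hasMulInverse.Build fps
  fps_mulVx fps_unitPl fps_inv_out.

End FPS.

Arguments fpsC {n K} a.
Arguments fpsX {n K} i.

(* [nxt] is the cyclic order at the vertices: it is a 3-cycle on the three
   half-edges at each vertex. *)
Record trivalent_graph := TrivalentGraph {
  vertex : finType;
  edge : finType;
  halfedge : finType;
  hvertex : halfedge -> vertex;
  hedge : halfedge -> edge;
  nxt : halfedge -> halfedge;
  vertex_gt0 : (0 < #|vertex|)%N;
  card_vertex : forall v, #|[set h | hvertex h == v]%SET| = 3%N;
  card_edge : forall e, #|[set h | hedge h == e]%SET| = 2%N;
  hvertex_nxt : forall h, hvertex (nxt h) = hvertex h;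
  nxt_neq : forall h, nxt h != h;
  nxt3 : forall h, nxt (nxt (nxt h)) = h;
  graph_connected : forall v w, connect
    [rel x y | [exists h, exists h',
       [&& hvertex h == x, hvertex h' == y & hedge h == hedge h']]] v w
}.

Definition admissible_triple (a b c : nat) : bool :=
  [&& ~~ odd (a + b + c), a <= b + c, b <= a + c & c <= a + b]%N.

Definition admissible (Gamma : trivalent_graph) (c : edge Gamma -> nat) : bool :=
  [forall h, admissible_triple (c (hedge h)) (c (hedge (nxt h)))
                               (c (hedge (nxt (nxt h))))].

Section Evaluation.
Variables (Gamma : trivalent_graph) (le : rel (halfedge Gamma)).
Implicit Types (v : vertex Gamma) (e f : edge Gamma) (h : halfedge Gamma).

(* The half-edges at a vertex (resp. of an edge), in increasing order; these
   lists have size 3 (resp. 2), so the default branches of the pattern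
   matchings below are never used. *)
Definition halves_at v : seq (halfedge Gamma) :=
  sort le (enum [set h | hvertex h == v]%SET).
Definition halves_of e : seq (halfedge Gamma) :=
  sort le (enum [set h | hedge h == e]%SET).

Definition half_edge_order : Prop :=
  [/\ total le, antisymmetric le, transitive le,
      forall h1 h2 h3, hvertex h1 = hvertex h3 -> le h1 h2 -> le h2 h3 ->
        hvertex h2 = hvertex h1
    & forall v, exists h, halves_at v = [:: h; nxt h; nxt (nxt h)]].

(* e_1 < f_1 < e_2 < f_2: for each crossing pair {e, f} this holds of exactly
   one of (e, f) and (f, e). *)
Definition interleaved e f : bool :=
  match halves_of e, halves_of f with
  | [:: e1; e2], [:: f1; f2] =>
      sorted (fun h h' => (h != h') && le h h') [:: e1; f1; e2; f2]
  | _, _ => false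
  end.

Variables (K : fieldType) (psi : halfedge Gamma -> 'M[K]_2) (c : edge Gamma -> nat).

Local Notation nvar := #|{: halfedge Gamma * bool}|.
Local Notation poly := (mpoly nvar K).

Definition zidx h : 'I_nvar := enum_rank (h, false).
Definition widx h : 'I_nvar := enum_rank (h, true).

Definition zvar h : poly := mpolyX K (mnm1 (zidx h)).
Definition wvar h : poly := mpolyX K (mnm1 (widx h)).

Definition zpsi h : poly :=
  invmx (psi h) 0 0 *: zvar h + invmx (psi h) 0 1 *: wvar h.
Definition wpsi h : poly :=
  invmx (psi h) 1 0 *: zvar h + invmx (psi h) 1 1 *: wvar h.

Definition hcol h : nat := c (hedge h).

Definition epsilon v : poly :=
  if halves_at v is [:: v1; v2; v3] then
      (zpsi v2 * wpsi v1 - zpsi v1 * wpsi v2)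
        ^+ ((hcol v1 + hcol v2 - hcol v3)./2)%N
    * (zpsi v3 * wpsi v2 - zpsi v2 * wpsi v3)
        ^+ ((hcol v2 + hcol v3 - hcol v1)./2)%N
    * (zpsi v3 * wpsi v1 - zpsi v1 * wpsi v3)
        ^+ ((hcol v1 + hcol v3 - hcol v2)./2)%N
  else 1.

Definition omega e (p : poly) : poly :=
  if halves_of e is [:: e1; e2] then
      mderiv (zidx e1) (mderiv (widx e2) p)
    - mderiv (zidx e2) (mderiv (widx e1) p)
  else p.

(* For admissible c, the polynomial obtained by applying the (commuting)
   operators omega_e^(c_e) is constant; the evaluation is its value. *)
Definition evaluation : K :=
  (-1) ^+ (\sum_e \sum_(f | interleaved e f) c e * c f)%N
  * (\prod_e ((c e)`!%:R ^+ 2)^-1)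
  * mcoeff (@mnm0 nvar)
      (foldr (fun e => iter (c e) (omega e)) (\prod_v epsilon v)
             (enum (edge Gamma))).

Definition theta (i j k : nat) : K :=
  (((i + j + k)./2.+1)`! * ((i + j - k)./2)`!
     * ((i + k - j)./2)`! * ((j + k - i)./2)`!)%N%:R
  / (i`! * j`! * k`!)%N%:R.

Definition normalized_evaluation : K :=
  evaluation ^+ 2 /
  \prod_v (if halves_at v is [:: v1; v2; v3]
           then theta (hcol v1) (hcol v2) (hcol v3) else 1).

End Evaluation.

Definition Yvar (Gamma : trivalent_graph) (K : fieldType) (e : edge Gamma) :
  fps #|edge Gamma| K := fpsX (enum_rank e).

Definition Wseries (Gamma : trivalent_graph) (le : rel (halfedge Gamma))
    (K : fieldType) (psi : halfedge Gamma -> 'M[K]_2) : fps #|edge Gamma| K :=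
  fun m => let c := fun e => m (enum_rank e) in
    if admissible c then normalized_evaluation le psi c else 0.

Record su2 (R : realType) := SU2 {
  su2_mx :> 'M[R[i]]_2;
  su2P : (su2_mx \is unitarymx) && (\det su2_mx == 1)
}.

Section SU2.
Variable R : realType.
Local Notation C := (R[i]).

HB.instance Definition _ := [isSub for @su2_mx R].
HB.instance Definition _ := [Choice of su2 R by <:].

Fact su2_one_subproof :
  ((1%:M : 'M[C]_2) \is unitarymx) && (\det (1%:M : 'M[C]_2) == 1).
Proof. by rewrite det1 eqxx andbT; apply/unitarymxP; rewrite trmx1 map_mx1 mulmx1. Qed.

Fact su2_mul_subproof (g h : su2 R) :
  (g *m h \is unitarymx) && (\det (g *m h) == 1).
Proof.
case: g h => [g /andP[gu /eqP dg]] [h /andP[hu /eqP dh]] /=.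
by rewrite mul_unitarymx// det_mulmx dg dh mulr1 eqxx.
Qed.

Fact su2_inv_subproof (g : su2 R) :
  (invmx g \is unitarymx) && (\det (invmx g) == 1).
Proof.
case: g => [g /andP[gu /eqP dg]] /=.
by rewrite det_inv dg invr1 eqxx andbT invmx_unitary// trmxC_unitary.
Qed.

Definition su2_one := SU2 su2_one_subproof.
Definition su2_mul g h := SU2 (su2_mul_subproof g h).
Definition su2_inv g := SU2 (su2_inv_subproof g).

Fact su2_mulA : associative su2_mul.
Proof. by move=> a b c; apply/val_inj; rewrite /= mulmxA. Qed.
Fact su2_mul1g : left_id su2_one su2_mul.
Proof. by move=> a; apply/val_inj; rewrite /= mul1mx. Qed.
Fact su2_mulg1 : right_id su2_one su2_mul.
Proof. by move=> a; apply/val_inj; rewrite /= mulmx1. Qed.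
Fact su2_unit (g : su2 R) : su2_mx g \in unitmx.
Proof. by have /andP[/unitarymx_unit] := su2P g. Qed.
Fact su2_mulVg : left_inverse su2_one su2_inv su2_mul.
Proof. by move=> a; apply/val_inj; rewrite /= mulVmx ?su2_unit. Qed.
Fact su2_mulgV : right_inverse su2_one su2_inv su2_mul.
Proof. by move=> a; apply/val_inj; rewrite /= mulmxV ?su2_unit. Qed.

HB.instance Definition _ := isGroup.Build (su2 R)
  su2_mulA su2_mul1g su2_mulg1 su2_mulVg su2_mulgV.

HB.instance Definition _ := isPointed.Build (su2 R) su2_one.

Definition su2_open : set (set (su2 R)) :=
  [set @su2_mx R @^-1` U | U in @open 'M[(R[i] : numFieldType)]_2].

HB.instance Definition _ := Measurable.copy (su2 R) (g_sigma_algebraType su2_open).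

(* SU(2) is compact, hence unimodular, so left invariance suffices. *)
Definition is_haar (mu : probability (su2 R) R) : Prop :=
  forall (g : su2 R) (A : set (su2 R)), measurable A ->
    mu [set (g * h)%g | h in A] = mu A.

End SU2.

Section Power.
Context d (T : measurableType d) (R : realType) (P : probability T R).

Definition consT n (x : T * n.-tuple T) : n.+1.-tuple T := [tuple of x.1 :: x.2].

Fact measurable_consT n : measurable_fun [set: T * n.-tuple T] (@consT n).
Proof.
by apply: measurable_cons; [exact: measurable_fst|exact: measurable_snd].
Qed.

HB.instance Definition _ n :=
  isMeasurableFun.Build _ _ _ _ (@consT n) (@measurable_consT n).

Fixpoint power_measure n : probability (n.-tuple T) R :=
  match n with
  | 0 => \d_([tuple])
  | n'.+1 => distribution (P \x power_measure n')%E (@consT n')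
  end.

End Power.

Definition Cintegral d (T : measurableType d) (R : realType)
    (mu : {measure set T -> \bar R}) (f : T -> R[i]) : R[i] :=
  ((\int[mu]_x complex.Re (f x)) +i* (\int[mu]_x complex.Im (f x)))%C.

Definition fps_integral d (T : measurableType d) (R : realType)
    (mu : {measure set T -> \bar R}) n (F : T -> fps n R[i]) : fps n R[i] :=
  fun m => Cintegral mu (fun x => F x m).

(* Main.v *)
From HB Require Import structures.
Require Import Defs.
From mathcomp Require Import all_boot all_order all_algebra.
From mathcomp Require Import zify ring.
From mathcomp Require Import sesquilinear spectral complex.
From mathcomp Require Import -(notations) mpoly.
From mathcomp Require Import all_classical all_reals all_analysis.
From mathcomp Require Import measurable_realfun.

Set Implicit Arguments.
Unset Strict Implicit.
Unset Printing Implicit Defensive.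

Import Order.TTheory GRing.Theory Num.Theory.
Import numFieldNormedType.Exports.

(** Write omega(x, y) for the determinant of two vectors of C^2. For matrices
    A1, A2 of determinant 1, the inverse of det (A2 - Y A1) is the generating
    series of the polynomials U_n of [chebU] at the mixed determinant tau of A1
    and A2, that is, of the characters of the symmetric powers at A1 A2^-1
    ([inv_prod_coef]). The coefficient of Y^c on the right is therefore the
    integral over G^V of the product over the edges of U_(c e) (tau_e); it has
    to be the square of the evaluation, divided by the theta values.

    At a vertex, for vectors u_i and u'_i, the integral over g in SU(2) of the
    product over i = 1, 2, 3 of omega(u_i, g u'_i)^(c_i) is
    epsilon(u) epsilon(u') / <c_1, c_2, c_3> if c is admissible and 0 if not
    ([vertex_integral]). This comes from one generating function: the integral
    of tr(gN)^(2s) is the Catalan number of s times det(N)^s, for every complex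
    matrix N ([moment_even], [catalan_moment]), and with
    N = sum_i t_i u'_i (J u_i)^T, where omega(x, y) is the scalar product of J x
    and y, the determinant of N is
    sum_(i < j) t_i t_j omega(u_i, u_j) omega(u'_i, u'_j), so that it remains to
    compare the coefficients of the monomials in t. The formula for tr(gN) is
    left invariance when N is a real multiple of an element of SU(2); it
    propagates to all N because these matrices are the points of a real form of
    the space of complex matrices and both sides are polynomials in N.

    Along an edge, let S = a z_1 z_2 + b z_1 w_2 + g w_1 z_2 + d w_1 w_2,
    tau = b - g and delta = a d - b g. Cayley's operator Omega satisfies
    Omega^n S^n = n!^2 U_n(tau, delta) ([cayley_power]). For S of rank one,
    delta = 0 and U_n = tau^n; for S coming from two matrices of determinant 1,
    U_n is the character above.

    The evaluation is, up to a sign, the value of a linear form, the contraction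
    of the edges, at the product E of the epsilon_v. Multiplying the vertex
    formulas by Fubini gives, with one set of variables x and one set y on the
    two sides of the group elements, the integral of the product over the
    half-edges of omega(x_h, A_h y_h)^(c_h), where A_h = psi_h g_v psi_h^-1: it
    is E(x) E(y) divided by the theta values, or 0 if c is not admissible
    ([graph_integral]). A linear form on polynomials passes through the integral
    ([Cintegral_linear_form]). Contracting in x meets bilinear forms of rank one
    and yields the product over the edges of omega(A_1 y_1, A_2 y_2)^(c_e)
    ([partial_contraction_integral]); contracting in y then yields the product
    of the U_(c e) (tau_e) ([contraction_integral]). On the other side E has been
    contracted twice, which is the square of the evaluation: its sign is
    gone. *)

Local Open Scope classical_set_scope.
Local Open Scope ring_scope.

(** * Polynomials are determined by their values *)

Lemma eq_poly_nat (K : numDomainType) (p q : {poly K}) :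
  (forall k : nat, p.[k%:R] = q.[k%:R]) -> p = q.
Proof.
move=> pq; apply/eqP; rewrite -subr_eq0; apply/eqP.
pose rs := [seq k%:R : K | k <- iota 0 (size (p - q))].
apply: (@roots_geq_poly_eq0 _ _ rs).
- by apply/allP => _ /mapP[k _ ->]; rewrite /root !hornerE pq subrr.
- by rewrite map_inj_uniq ?iota_uniq// => i j /eqP; rewrite eqr_nat => /eqP.
- by rewrite size_map size_iota.
Qed.

Local Notation widen := (widen_ord (leqnSn _)).

(** Induction on the number of variables: freezing all variables but the last
    gives a polynomial in one variable that vanishes at every integer, so all
    its coefficients, which are polynomials in the frozen variables, vanish
    everywhere. *)
Lemma eq_mpoly_eval (K : numDomainType) n (p q : mpoly n K) :
  (forall x, meval x p = meval x q) -> p = q.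
Proof.
move=> pq; apply/eqP; rewrite -subr_eq0; apply/eqP.
have: forall x, meval x (p - q) = 0 by move=> x; rewrite mevalB pq subrr.
move: (p - q) => r {p q pq}; elim: n r => [|n IH] p p0.
  have Em (m : multinom 0) : m = @mnm0 0 by apply/mnmP => -[].
  apply/mpolyP => m; rewrite (Em m) mcoeff0.
  have := p0 (fun=> 0); rewrite mevalE; case: (boolP (@mnm0 0 \in msupp p)) => [s0 H|].
    move: H; rewrite (bigD1_seq (@mnm0 0))//= big_ord0 mulr1 big1 ?addr0//.
    by move=> k; rewrite (Em k) eqxx.
  by rewrite mcoeff_msupp negbK => /eqP.
have ev (x : 'I_n -> K) (t : K) : (map_poly (meval x) (muni p)).[t] = 0.
  rewrite -[RHS](p0 (fun i => if unlift ord_max i is Some j then x j else t)).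
  rewrite mevalE muniE rmorph_sum/= horner_sum; apply: eq_bigr => m _.
  rewrite -!mul_polyC !rmorphM/= !map_polyC/= map_polyXn !hornerE/= mevalZ mevalX.
  rewrite big_ord_recr/= unlift_none mulrA; congr (_ * _ * _).
  apply: eq_bigr => i _; rewrite mnmE.
  have -> : widen i = lift ord_max i by apply: ord_inj; rewrite lift_max.
  by rewrite liftK.
have u0 : muni p = 0.
  apply/polyP => i; rewrite coef0; apply: IH => x.
  rewrite -coef_map/= (_ : map_poly _ _ = 0) ?coef0//.
  by apply: eq_poly_nat => k; rewrite ev horner0.
apply/mpolyP => m; rewrite mcoeff0.
have := congr1 (fun P : {poly mpoly n K} => mcoeff (Multinom [tuple m (widen i) | i < n]) P`_(m ord_max)) u0.
rewrite coef0 mcoeff0 => <-.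
rewrite muniE coef_sum raddf_sum/=.
have E m' : mcoeff (Multinom [tuple m (widen i) | i < n])
  (mcoeff m' p *: mpolyX K (Multinom [tuple m' (widen i) | i < n])
     *: 'X^(m' ord_max) : {poly mpoly n K})`_(m ord_max) = mcoeff m' p * (m' == m)%:R.
  rewrite coefZ coefXn mulr_natr; have [->|nm] := eqVneq m' m.
    by rewrite eqxx !mulr1n mcoeffZ mcoeffX eqxx.
  case: (m ord_max =P m' ord_max) => [e|_]; last by rewrite mulr0n mcoeff0 mulr0.
  rewrite mulr1n mcoeffZ mcoeffX; congr (_ * (nat_of_bool _)%:R).
  apply: contraNF nm => /eqP E; apply/eqP/mnmP => i.
  have [j ->|->] := unliftP ord_max i; last by rewrite e.
  have -> : lift ord_max j = widen j by apply: ord_inj; rewrite lift_max.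
  by have := congr1 (fun M : multinom n => M j) E; rewrite /= !mnmE.
under eq_bigr do rewrite E.
have [ms|] := boolP (m \in msupp p).
  by rewrite (bigD1_seq m)//= eqxx mulr1 big1 ?addr0// => k /negbTE ->; rewrite mulr0.
move=> mp; rewrite big1_seq ?(memN_msupp_eq0 mp)// => k /andP[_ kp].
by case: eqP kp mp => [->->//|_ _ _]; rewrite mulr0.
Qed.

(** * Cayley's operator on the powers of a bilinear form *)

(** If tau = a + b and delta = a b, this is the complete homogeneous symmetric
    polynomial of degree n in a and b: the character of the n-th symmetric power
    at a matrix of trace tau and determinant delta. *)
Fixpoint chebU (K : pzRingType) (tau delta : K) (n : nat) : K :=
  match n with
  | 0 => 1
  | n'.+1 => if n' is n''.+1 then
               tau * chebU tau delta n' - delta * chebU tau delta n''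
             else tau
  end.

Lemma chebUSS (K : pzRingType) (tau delta : K) n :
  chebU tau delta n.+2 = tau * chebU tau delta n.+1 - delta * chebU tau delta n.
Proof. by []. Qed.

Lemma chebU0 (K : pzRingType) (tau : K) n : chebU tau 0 n = tau ^+ n.
Proof.
elim/ltn_ind: n => -[|[|n]] IH //.
by rewrite chebUSS mul0r subr0 IH// -exprS.
Qed.

(** The next three identities are the computations that Cayley's operator
    requires, with the derivatives replaced by independent variables. *)
Lemma cayley_mul_identity (R : comPzRingType) (x y z w F dz1 dw1 dz2 dw2 p p' : R) :
  1 * F + x * dz1 + (w * dw2 + (x * w - y * z) * p)
  - (-1 * F + - z * dz2 + (- y * dw1 + (x * w - y * z) * p')) =
  (x * w - y * z) * (p - p') + (x * dz1 + y * dw1 + F + (z * dz2 + w * dw2 + F)).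
Proof. by ring. Qed.

Lemma euler_bilinear_identity (R : comPzRingType) (x y z w a b g d : R) :
  let S := a * (x * z) + b * (x * w) + g * (y * z) + d * (y * w) in
  x * (a * z + b * w) + y * (g * z + d * w) = S /\
  z * (a * x + g * y) + w * (b * x + d * y) = S.
Proof. by split; rewrite /=; ring. Qed.

Lemma cayley_power_identity (R : comPzRingType) (x y z w a b g d P : R) m :
  let S := a * (x * z) + b * (x * w) + g * (y * z) + d * (y * w) in
  (b * 1 * (S * P) + (b * x + d * y) * ((a * z + b * w) * P *+ m.+1)) *+ m.+2
  - (g * 1 * (S * P) + (g * z + d * w) * ((a * x + g * y) * P *+ m.+1)) *+ m.+2
  = m.+2%:R * m.+2%:R * (b - g) * (S * P)
  + - (m.+2%:R * m.+1%:R * (a * d - b * g)) * ((x * w - y * z) * P).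
Proof. by move=> S; rewrite /S; ring. Qed.

Section CayleyOmega.
Variables (K : comNzRingType) (N : nat) (z1 w1 z2 w2 : 'I_N).
Hypothesis idx_uniq : uniq [:: z1; w1; z2; w2].
Local Notation A := (mpoly N K).
Local Notation D := (@mderiv N K).
Local Notation X i := (mpolyX K (mnm1 i) : A).

Definition cayley (p : A) : A := D z1 (D w2 p) - D z2 (D w1 p).

(* The symplectic form of the two pairs of variables; Cayley's operator is the
   same expression in the derivatives. *)
Let q : A := X z1 * X w2 - X w1 * X z2.

Lemma mderivXU (i j : 'I_N) : D i (X j) = (i == j)%:R.
Proof.
rewrite mderivX mnm1E eq_sym; case: eqP => [->|_]; last by rewrite scale0r.
by rewrite (_ : mnm_sub _ _ = @mnm0 N) ?scale1r ?mpolyX0//; apply/mnmP => k; rewrite mnmBE subnn mnm0E.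
Qed.

Lemma mderivXn (i : 'I_N) (p : A) k : D i (p ^+ k.+1) = D i p * p ^+ k *+ k.+1.
Proof.
elim: k => [|k IH]; first by rewrite mulr1.
rewrite exprS mderivM IH mulrnAr [in RHS]mulrS; congr (_ + _ *+ _).
by rewrite mulrCA -exprS.
Qed.

Let neqs : ((z1 == w1) = false) * ((z1 == z2) = false) * ((z1 == w2) = false)
  * ((w1 == z2) = false) * ((w1 == w2) = false) * ((z2 == w2) = false).
Proof.
move: idx_uniq => /=; rewrite !inE !negb_or => /andP[/and3P[a b c] /andP[/andP[d e] /andP[f _]]].
by do !split; apply/negbTE.
Qed.

Let dX : ((D z1 (X z1) = 1) * (D z1 (X w1) = 0) * (D z1 (X z2) = 0) * (D z1 (X w2) = 0)
  * (D w1 (X z1) = 0) * (D w1 (X w1) = 1) * (D w1 (X z2) = 0) * (D w1 (X w2) = 0)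
  * (D z2 (X z1) = 0) * (D z2 (X w1) = 0) * (D z2 (X z2) = 1) * (D z2 (X w2) = 0)
  * (D w2 (X z1) = 0) * (D w2 (X w1) = 0) * (D w2 (X z2) = 0) * (D w2 (X w2) = 1))%type.
Proof.
have [[[[[e1 e2] e3] e4] e5] e6] := neqs.
by do !split; rewrite mderivXU ?eqxx// ?e1 ?e2 ?e3 ?e4 ?e5 ?e6// eq_sym ?e1 ?e2 ?e3 ?e4 ?e5 ?e6.
Qed.

Let D1 i : D i 1 = 0. Proof. exact: (mderivC i 1). Qed.

Let dE := (@mderivD, @mderivB, @mderivN, @mderivM, @mderivZ, @mderivC).

(* A polynomial is bihomogeneous of degree (m, m) as soon as both Euler operators
   multiply it by m; only these two eigenvalue equations matter below. *)
Let euler (z w : 'I_N) (F : A) : A := X z * D z F + X w * D w F.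
Let bihom m F := euler z1 w1 F = F *+ m /\ euler z2 w2 F = F *+ m.

Let eulerM z w F G : euler z w (F * G) = euler z w F * G + F * euler z w G.
Proof. by rewrite /euler !mderivM; ring. Qed.

Let euler_mderiv z w i F : euler z w (D i F) =
  D i (euler z w F) - (i == z)%:R * D z F - (i == w)%:R * D w F.
Proof.
by rewrite /euler !dE !mderivXU ![D i (D _ F)](mderiv_comm _ i); ring.
Qed.

Let eulerB z w F G : euler z w (F - G) = euler z w F - euler z w G.
Proof. by rewrite /euler !dE; ring. Qed.

Let cayley_bihom m F : bihom m.+1 F -> bihom m (cayley F).
Proof.
have [[[[[e1 e2] e3] e4] e5] e6] := neqs.
move=> [E1 E2]; rewrite /bihom /cayley !eulerB !euler_mderiv E1 E2.
rewrite ?eqxx ?(eq_sym z2) ?(eq_sym w2) ?(eq_sym w1 z1).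
rewrite ?e1 ?e2 ?e3 ?e4 ?e5 ?e6 !(mul0r, mul1r, subr0) !(mderivB, mderivMn).
by rewrite !mulrSr !addrK mulrnBl.
Qed.

Let cayley_is_linear : linear cayley.
Proof.
move=> c F G; rewrite /cayley !(mderivD, mderivZ) scalerBr.
by rewrite opprD addrACA.
Qed.
HB.instance Definition _ := GRing.isLinear.Build K A A _ cayley cayley_is_linear.

Let dq : (D z1 q = X w2) * (D w2 q = X z1) * (D z2 q = - X w1) * (D w1 q = - X z2).
Proof.
by rewrite /q !dE !dX !(mul0r, mul1r, mulr1, mulr0, add0r, addr0, subr0, sub0r).
Qed.

(* Omega (q F) = q Omega F + (2 + E1 + E2) F for the two Euler operators E1 and
   E2: the commutator of Omega and q is a Cartan element of an sl_2. *)
Let cayley_q m F : bihom m F -> cayley (q * F) = q * cayley F + F *+ (m.+1 * 2).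
Proof.
move=> [E1 E2].
rewrite /cayley !mderivM !dq !mderivD !mderivM !mderivN !dq !dX.
rewrite mulrnA [F *+ m.+1]mulrSr mulr2n -{1}E1 -E2 /euler.
exact: cayley_mul_identity.
Qed.

Let cayley_iter_bihom k m F : bihom (m + k) F -> bihom m (iter k cayley F).
Proof.
elim: k m => [|k IH] m; first by rewrite addn0.
by rewrite addnS -addSn => /IH/cayley_bihom.
Qed.

(* F has degree m + k, so the k-th step of the iteration sees the degree m and
   the commutators add up to the sum of 2 (m + i + 1) for 0 <= i <= k. *)
Let cayley_iter_q k m F : bihom (m + k) F ->
  iter k.+1 cayley (q * F) =
  q * iter k.+1 cayley F + iter k cayley F *+ (k.+1 * (k + m.*2).+2).
Proof.
elim: k m => [|k IH] m Fh.
  by rewrite addn0 in Fh; rewrite /= (cayley_q Fh) mul1n muln2 doubleS.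
have Fh' := cayley_iter_bihom Fh.
rewrite iterS (IH m.+1) ?addSnnS// linearD linearMn/= (@cayley_q m)//.
rewrite -addrA -mulrnDr; set u := (_ + _)%N; set v := (_ * _)%N.
by have -> : u = v by rewrite /u /v -!muln2; lia.
Qed.

Section Power.
Variables a b g d : K.
Let S : A := a *: (X z1 * X z2) + b *: (X z1 * X w2) + g *: (X w1 * X z2)
  + d *: (X w1 * X w2).

Let dS : (D z1 S = a *: X z2 + b *: X w2) * (D w1 S = g *: X z2 + d *: X w2) *
  (D z2 S = a *: X z1 + g *: X w1) * (D w2 S = b *: X z1 + d *: X w1).
Proof.
rewrite /S !dE !dX !(mul0r, mul1r, mulr1, mulr0, add0r, addr0, subr0, sub0r) !scaler0.
by rewrite !(addr0, add0r).
Qed.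

Let bihomS m : bihom m (S ^+ m).
Proof.
have [H1 H2] : euler z1 w1 S = S /\ euler z2 w2 S = S.
  rewrite /euler !dS /S -!mul_mpolyC.
  exact: euler_bilinear_identity.
elim: m => [|m [IH1 IH2]]; first by rewrite /bihom /euler !D1 !mulr0 addr0 mulr0n.
by split; rewrite exprS eulerM ?H1 ?H2 ?IH1 ?IH2 mulrnAr mulrS.
Qed.

Let tau := b - g.
Let delta := a * d - b * g.

(* The Leibniz rule produces the term S_z1 S_w2 - S_z2 S_w1, which is
   tau S - delta q. *)
Let cayleyS m : cayley (S ^+ m.+2) =
  (m.+2%:R ^+ 2 * tau) *: S ^+ m.+1 + (- (m.+2%:R * m.+1%:R * delta)) *: (q * S ^+ m).
Proof.
rewrite /cayley !mderivXn !mderivMn !mderivM !mderivXn !dS.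
rewrite !mderivD !mderivZ !dX !scaler0 !(add0r, addr0) [S ^+ m.+1]exprS.
rewrite -!mul_mpolyC !(mpolyCN, mpolyCM, mpolyCB).
rewrite !mpolyC_nat /S -!mul_mpolyC.
exact: cayley_power_identity.
Qed.

Let iter_cayley_linear k : linear (iter k cayley).
Proof.
elim: k => [|k IH] c F G; first by [].
rewrite !iterS IH.
exact: cayley_is_linear.
Qed.

(** Applying Omega once turns S^n into n^2 tau S^(n-1) - n (n-1) delta q S^(n-2).
    The first term is known by induction. In the second, commuting the remaining
    n - 1 operators with q leaves n (n-1) Omega^(n-2) S^(n-2), since
    Omega^(n-2) S^(n-2) is already a constant. This is the recurrence of
    [chebU]. *)
Lemma cayley_power n :
  iter n cayley (S ^+ n) = mpolyC N ((n`!)%:R ^+ 2 * chebU tau delta n).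
Proof.
elim/ltn_ind: n => -[|[|n]] IH.
- by rewrite /= expr0 fact0 expr1n mulr1.
- rewrite /= expr1 expr1n mul1r /cayley !dS !mderivD !mderivZ !dX.
  by rewrite !scaler0 !addr0 -scalerBl -mul_mpolyC mulr1.
have iter0 k : iter k cayley 0 = 0.
  by elim: k => // k IHk; rewrite iterS IHk /cayley !mderiv0 subr0.
have iterZ k c F : iter k cayley (c *: F) = c *: iter k cayley F.
  by rewrite -[c *: F]addr0 iter_cayley_linear iter0 addr0.
rewrite iterSr cayleyS iter_cayley_linear iterZ (@cayley_iter_q n 0 _ (bihomS n)) ?IH//.
rewrite iterS IH// /cayley !mderivC ?mderiv0 subr0 mulr0 add0r.
rewrite -mpolyCMn -!mul_mpolyC -!mpolyCM -mpolyCD; congr mpolyC.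
rewrite chebUSS double0 addn0 -mulr_natr !factS !natrM.
ring.
Qed.
End Power.
End CayleyOmega.

(** * Contracting the edges of a graph *)

Section Contraction.
Variables (Gamma : trivalent_graph) (le : rel (halfedge Gamma)).
Variables (K : numFieldType) (c : edge Gamma -> nat).
Local Notation nvar := #|{: halfedge Gamma * bool}|.
Local Notation poly := (mpoly nvar K).
Local Notation z h := (zvar K h).
Local Notation w h := (wvar K h).
Implicit Types (e : edge Gamma) (h : halfedge Gamma) (p q : poly).

(** The default branches of the definitions on [halves_of] are never taken. *)
Lemma halves_ofP e : exists e1 e2 : halfedge Gamma, [/\ halves_of le e = [:: e1; e2],
  hedge e1 = e, hedge e2 = e & e1 != e2].
Proof.
have H : perm_eq (halves_of le e) (enum [set h | hedge h == e]%SET).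
  by rewrite /halves_of perm_sort.
have S : size (halves_of le e) = 2 by rewrite (perm_size H) -cardE card_edge.
have U : uniq (halves_of le e) by rewrite (perm_uniq H) enum_uniq.
have M h : (h \in halves_of le e) = (hedge h == e).
  by rewrite (perm_mem H) mem_enum inE.
case: (halves_of le e) S U M => [|e1 [|e2 [|]]]//= _; rewrite inE andbT => U M.
exists e1, e2; split => //; apply/eqP; rewrite -M !inE eqxx ?orbT//.
Qed.

(* The polynomials that omega_e treats as constants. *)
Let free e p := forall h, hedge h = e ->
  mderiv (zidx h) p = 0 /\ mderiv (widx h) p = 0.

Let freeM e p q : free e p -> free e q -> free e (p * q).
Proof.
by move=> fp fq h he; have [p1 p2] := fp _ he; have [q1 q2] := fq _ he;
   rewrite !mderivM p1 p2 q1 q2 !mul0r !mulr0 addr0.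
Qed.

Let freeC e (a : K) : free e (mpolyC nvar a).
Proof. by move=> h _; rewrite !mderivC. Qed.

Let freeXn e p k : free e p -> free e (p ^+ k).
Proof.
move=> fp; elim: k => [|k IH]; first by rewrite expr0 -mpolyC1; exact: freeC.
by rewrite exprS; apply: freeM.
Qed.

Let omegaM e p q : free e q -> omega le e (q * p) = q * omega le e p.
Proof.
have [e1 [e2 [E h1 h2 _]]] := halves_ofP e.
move=> fq; have [q1 q2] := fq _ h1; have [q3 q4] := fq _ h2.
by rewrite /omega E !mderivM q2 q4 !mul0r !add0r !mderivM q1 q3 !mul0r !add0r mulrBr.
Qed.

Let iter_omegaM e p q k : free e q -> iter k (omega le e) (q * p) = q * iter k (omega le e) p.
Proof. by move=> fq; elim: k => // k IH; rewrite !iterS IH omegaM. Qed.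

(** The evaluation without the sign of its crossings, as a function of the
    polynomial to which the operators of the edges are applied. *)
Definition contract_edges p : K :=
  (\prod_e ((c e)`!%:R ^+ 2)^-1)
  * mcoeff (@mnm0 nvar) (foldr (fun e => iter (c e) (omega le e)) p (enum (edge Gamma))).

Lemma evaluation_contraction (psi : halfedge Gamma -> 'M[K]_2) :
  evaluation le psi c = (-1) ^+ (\sum_e \sum_(f | interleaved le e f) c e * c f)%N
    * contract_edges (\prod_v epsilon le psi c v).
Proof. by rewrite /evaluation /contract_edges mulrA. Qed.

Let omega_is_linear e : linear (omega le e : poly -> poly).
Proof.
have [e1 [e2 [E _ _ _]]] := halves_ofP e; move=> a p q.
by rewrite /omega E !(mderivD, mderivZ) scalerBr opprD addrACA.
Qed.

Fact contract_edges_is_linear : linear_for *%R contract_edges.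
Proof.
move=> a p q; rewrite /contract_edges.
suff -> : foldr (fun e => iter (c e) (omega le e)) (a *: p + q) (enum (edge Gamma))
   = a *: foldr (fun e => iter (c e) (omega le e)) p (enum (edge Gamma)) +
   foldr (fun e => iter (c e) (omega le e)) q (enum (edge Gamma)).
  by rewrite mcoeffD mcoeffZ mulrDr mulrCA.
elim: (enum _) => // e s IH; rewrite [LHS]/= IH [RHS]/=.
by elim: (c e) => // k IHk; rewrite !iterS IHk omega_is_linear.
Qed.

HB.instance Definition _ := GRing.isLinear.Build K poly K _ contract_edges contract_edges_is_linear.

Variables (al be ga de : edge Gamma -> K).

Definition edge_form e : poly :=
  if halves_of le e is [:: e1; e2] then
    al e *: (z e1 * z e2) + be e *: (z e1 * w e2)
    + ga e *: (w e1 * z e2) + de e *: (w e1 * w e2)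
  else 0.

Let free_var e b h : hedge h != e -> free e (mpolyX K (mnm1 (enum_rank (h, b)))).
Proof.
move=> hn h' he; rewrite !mderivXU /zidx /widx !(inj_eq enum_rank_inj) !xpair_eqE.
have -> : h' == h = false by apply: contraNF hn => /eqP <-; rewrite he.
by [].
Qed.

Let free_form e e' : e != e' -> free e' (edge_form e).
Proof.
have [e1 [e2 [E h1 h2 _]]] := halves_ofP e; move=> ee'; rewrite /edge_form E.
have f1 b : free e' (mpolyX K (mnm1 (enum_rank (e1, b)))) by apply: free_var; rewrite h1.
have f2 b : free e' (mpolyX K (mnm1 (enum_rank (e2, b)))) by apply: free_var; rewrite h2.
have fm b1 b2 := freeM (f1 b1) (f2 b2).
move=> h /[dup] he /fm fh; rewrite !mderivD !mderivZ.
have /fm H := he.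
rewrite !(fh _ _).1 !(fh _ _).2.
by rewrite !scaler0 !addr0.
Qed.

(** The operator of an edge sees the factors of the other edges as constants, so
    the contraction is computed edge by edge. *)
Lemma contract_edge_forms :
  contract_edges (\prod_e edge_form e ^+ c e) =
  \prod_e chebU (be e - ga e) (al e * de e - be e * ga e) (c e).
Proof.
pose k e := (c e)`!%:R ^+ 2 * chebU (be e - ga e) (al e * de e - be e * ga e) (c e).
have Ek e : iter (c e) (omega le e) (edge_form e ^+ c e) = mpolyC nvar (k e).
  have [e1 [e2 [E h1 h2 n12]]] := halves_ofP e; rewrite /k -(@cayley_power _ _ (zidx e1) (widx e1) (zidx e2) (widx e2)).
    rewrite /edge_form E; apply: eq_iter => p; by rewrite /omega E.
  by rewrite /zidx /widx /= !inE !(inj_eq enum_rank_inj) !xpair_eqE !eqxx (negbTE n12).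
rewrite /contract_edges.
have F s G : uniq s -> {in s, forall e, free e G} ->
    foldr (fun e => iter (c e) (omega le e)) (G * \prod_(e <- s) edge_form e ^+ c e) s
    = G * mpolyC nvar (\prod_(e <- s) k e).
  elim: s G => [|e s IH] G; first by rewrite !big_nil mpolyC1.
  rewrite [uniq _]/= => /andP[es us] Gf; rewrite !big_cons mulrA [LHS]/= IH//; last first.
    move=> e' e's; apply: freeM; first by apply: Gf; rewrite inE e's orbT.
    by apply: freeXn; apply: free_form; apply: contraNneq es => ->.
  rewrite -mulrA (mulrC (edge_form e ^+ c e)) iter_omegaM; last by apply: Gf; rewrite mem_head.
  rewrite iter_omegaM; last exact: freeC.
  by rewrite Ek -mpolyCM (mulrC _ (k e)).
have := F (enum (edge Gamma)) 1 (enum_uniq _) _; rewrite !mul1r !big_enum/= => ->; last first.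
  by move=> e _; rewrite -mpolyC1; exact: freeC.
rewrite mcoeffC eqxx mulr1 -big_split; apply: eq_bigr => e _.
rewrite /= /k mulKf// expf_neq0// pnatr_eq0 -lt0n fact_gt0//.
Qed.
End Contraction.

(** * The inverse of the product of the determinants *)

Section SeriesCoefficients.
Variables (n : nat) (K : fieldType).
Implicit Types (F G : fps n K) (m : multinom n).

(** Products of series are computed on truncations, that is, on polynomials. *)
Lemma coef_fpsCM a F m : (fpsC a * F) m = a * F m.
Proof.
rewrite -[LHS]/(fps_mul _ _ _).
rewrite (@fps_mulE _ _ (mdeg m).+1 _ _ _ (mpolyC n a) (fps_trunc (mdeg m).+1 F))//.
- by rewrite mcoeffCM fps_truncE.
- by move=> k _; rewrite mcoeffC /fpsC mulr_natr eq_sym.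
- by move=> k km; rewrite fps_truncE.
Qed.

Lemma coef_fpsXM i F m : (fpsX i * F) m = if m i is 0 then 0 else F (mnm_sub m (mnm1 i)).
Proof.
rewrite -[LHS]/(fps_mul _ _ _).
rewrite (@fps_mulE _ _ (mdeg m).+1 _ _ _ (mpolyX K (mnm1 i)) (fps_trunc (mdeg m).+1 F))//.
- case E : (m i) => [|k].
    rewrite mcoeffM big1// => -[k1 k2]/= /eqP mE; rewrite mcoeffX.
    case: eqP => [k1E|_]; last by rewrite mul0r.
    by have := congr1 (fun M : multinom n => M i) mE; rewrite E -k1E mnmDE mnm1E eqxx.
  have mE : m = mnm_add (mnm1 i) (mnm_sub m (mnm1 i)).
    apply/mnmP => j; rewrite mnmDE mnmBE mnm1E; case: eqP => [<-|_]; last by rewrite subn0.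
    by rewrite subnKC// E.
  rewrite [X in mcoeff X]mE mulrC mcoeffMX fps_truncE//.
  apply: leq_ltn_trans (ltnSn _); rewrite !mdegE; apply: leq_sum => j _.
  by rewrite mnmBE leq_subr.
- by move=> k _; rewrite mcoeffX /fpsX eq_sym.
- by move=> k km; rewrite fps_truncE.
Qed.

Lemma fpsC1 : fpsC 1 = 1 :> fps n K. Proof. by []. Qed.

Lemma fpsCM (a b : K) : fpsC (a * b) = fpsC a * fpsC b :> fps n K.
Proof. by apply/funext => m; rewrite coef_fpsCM /fpsC mulrnAr. Qed.

Lemma fpsCB (a b : K) : fpsC (a - b) = fpsC a - fpsC b :> fps n K.
Proof. by apply/funext => m; rewrite -[RHS]/(fpsC a m - fpsC b m) /fpsC mulrnBl. Qed.

Lemma fpsCD (a b : K) : fpsC (a + b) = fpsC a + fpsC b :> fps n K.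
Proof. by apply/funext => m; rewrite -[RHS]/(fpsC a m + fpsC b m) /fpsC mulrnDl. Qed.
End SeriesCoefficients.

Lemma det_2x2 (R : comPzRingType) (A : 'M[R]_2) :
  \det A = A 0 0 * A 1 1 - A 0 1 * A 1 0.
Proof.
rewrite (expand_det_row _ 0) !big_ord_recl big_ord0 addr0 /cofactor !det_mx11 !mxE/=.
rewrite expr0 mul1r expr1 mulN1r mulrN.
have -> : lift 0 0 = 1 :> 'I_2 by apply/val_inj.
have -> // : lift 1 0 = 0 :> 'I_2 by apply/val_inj.
Qed.

(** The polarization of the determinant: det (A - Y B) is
    det A - mixed_det A B * Y + det B * Y^2. *)
Definition mixed_det (R : pzRingType) (A B : 'M[R]_2) : R :=
  A 0 0 * B 1 1 + A 1 1 * B 0 0 - A 0 1 * B 1 0 - A 1 0 * B 0 1.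

Lemma det_sub_fps n (K : fieldType) (A B : 'M[K]_2) (Y : fps n K) :
  \det A = 1 -> \det B = 1 ->
  \det (map_mx fpsC A - Y *: map_mx fpsC B) = 1 - fpsC (mixed_det A B) * Y + Y * Y.
Proof.
rewrite !det_2x2 => dA dB; rewrite !mxE /mixed_det.
rewrite -(fpsC1 n K) -{1}dA -[Y * Y]mul1r -fpsC1 -dB.
rewrite !(fpsCB, fpsCD, fpsCM).
ring.
Qed.

Section InverseDeterminants.
Variables (I : finType) (K : fieldType) (tau : I -> K).
Local Notation n := #|I|.
Local Notation Y i := (fpsX (enum_rank i) : fps n K).

(** The inverse of the product of the factors with index in s, written down
    coefficient by coefficient: only the variables with index in s occur. *)
Definition cheb_series (s : seq I) : fps n K := fun m =>
  \prod_i (if i \in s then chebU (tau i) 1 (m (enum_rank i)) else (m (enum_rank i) == 0%N)%:R).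

Let Y_eq (i j : I) (m : multinom n) : j != i ->
   (mnm_sub m (mnm1 (enum_rank i))) (enum_rank j) = m (enum_rank j).
Proof. by move=> ji; rewrite mnmBE mnm1E (inj_eq enum_rank_inj) eq_sym (negbTE ji) subn0. Qed.

(** The factor of index i acts on the exponent of the variable i alone, where the
    recurrence of [chebU] cancels all terms of positive degree. *)
Lemma cheb_series_cons i s : i \notin s ->
  (1 - fpsC (tau i) * Y i + Y i * Y i) * cheb_series (i :: s) = cheb_series s.
Proof.
move=> si; apply/funext => m.
rewrite mulrDl mulrBl mul1r -!mulrA.
rewrite -[LHS]/(cheb_series (i :: s) m - (fpsC (tau i) * (Y i * cheb_series (i :: s))) m
  + (Y i * (Y i * cheb_series (i :: s))) m) coef_fpsCM !coef_fpsXM.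
pose P (m : multinom n) := \prod_(j | j != i)
  (if j \in s then chebU (tau j) 1 (m (enum_rank j)) else (m (enum_rank j) == 0%N)%:R).
have E1 m' : cheb_series (i :: s) m' = chebU (tau i) 1 (m' (enum_rank i)) * P m'.
  rewrite /cheb_series (bigD1 i)//= mem_head; congr (_ * _).
  by apply: eq_bigr => j ji; rewrite inE (negbTE ji).
have E2 : cheb_series s m = (m (enum_rank i) == 0%N)%:R * P m.
  by rewrite /cheb_series (bigD1 i)//= (negbTE si).
have PY m' : P (mnm_sub m' (mnm1 (enum_rank i))) = P m'.
  by apply: eq_bigr => j ji; rewrite Y_eq.
rewrite !E1 E2 !PY !mnmBE !mnm1E !eqxx.
case: (m (enum_rank i)) => [|[|k]].
- by rewrite mulr0 subr0 addr0.
- by rewrite subnn /= !(mulr0n, mul0r, mul1r, addr0) subrr.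
- by rewrite !subn1 !mulr0n mul0r [_.-1]/= chebUSS; ring.
Qed.

Lemma cheb_seriesP :
  (\prod_i (1 - fpsC (tau i) * Y i + Y i * Y i))^-1 = cheb_series (enum I).
Proof.
have prodE : (\prod_i (1 - fpsC (tau i) * Y i + Y i * Y i)) * cheb_series (enum I) = 1.
  rewrite -[X in X * _]big_enum/=.
  have E0 : cheb_series [::] = 1.
    apply/funext => m; rewrite /cheb_series -[RHS]/(fpsC 1 m) /fpsC.
    case: eqP => [->|mn0].
      by rewrite big1// => i _; rewrite mnm0E.
    have [i mi] : exists i : I, m (enum_rank i) != 0%N.
      apply/existsP; rewrite -negb_forall; apply/negP => /forallP H; apply: mn0.
      by apply/mnmP => i; rewrite mnm0E -(enum_valK i) (eqP (H _)).
    by rewrite (bigD1 i)//= (negbTE mi) mul0r.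
  rewrite -[RHS]E0; elim: (enum I) (enum_uniq I) => [|i s IH]; first by rewrite big_nil mul1r.
  rewrite cons_uniq big_cons => /andP[/cheb_series_cons is1 /IH <-].
  by rewrite -is1 mulrAC mulrC mulrA.
set p := (X in X^-1) in prodE *.
have u : p \is a GRing.unit by apply/unitrPr; exists (cheb_series (enum I)).
by rewrite -[RHS]mul1r -(mulVr u) -mulrA prodE mulr1.
Qed.

Lemma inv_prod_coef m : (\prod_i (1 - fpsC (tau i) * Y i + Y i * Y i))^-1 m =
  \prod_i chebU (tau i) 1 (m (enum_rank i)).
Proof. by rewrite cheb_seriesP; apply: eq_bigr => i _; rewrite mem_enum. Qed.
End InverseDeterminants.

(** * Integrals of bounded measurable complex functions *)

Section BoundedReal.
Context d (T : measurableType d) (R : realType).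
Implicit Types f g : T -> R.

(** Bounded measurable functions form an algebra of functions that are integrable
    for every probability, so that no integrability has to be carried along. *)
Definition bmfun f := measurable_fun [set: T] f /\ exists M, forall x, `|f x| <= M.

Lemma bmfun_cst a : bmfun (fun=> a).
Proof. by split; [exact: measurable_cst|exists `|a|]. Qed.

Lemma bmfunD f g : bmfun f -> bmfun g -> bmfun (fun x => f x + g x).
Proof.
move=> [mf [M fM]] [mg [N gN]]; split; first exact: measurable_funD.
by exists (M + N) => x; rewrite (le_trans (ler_normD _ _))// lerD.
Qed.

Lemma bmfunB f g : bmfun f -> bmfun g -> bmfun (fun x => f x - g x).
Proof.
move=> [mf [M fM]] [mg [N gN]]; split; first exact: measurable_funB.
by exists (M + N) => x; rewrite (le_trans (ler_normB _ _))// lerD.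
Qed.

Lemma bmfunM f g : bmfun f -> bmfun g -> bmfun (fun x => f x * g x).
Proof.
move=> [mf [M fM]] [mg [N gN]]; split; first exact: measurable_funM.
by exists (M * N) => x; rewrite normrM ler_pM.
Qed.

Variable P : probability T R.

Lemma bmfun_integrable f : bmfun f -> P.-integrable [set: T] (EFin \o f).
Proof.
move=> [mf [M fM]]; apply: measurable_bounded_integrable => //.
  by rewrite (le_lt_trans (probability_le1 P measurableT))// ltry.
exists M; split; first exact: num_real.
by move=> x Mx y _ /=; apply: le_trans (fM y) (ltW Mx).
Qed.
End BoundedReal.

Lemma bmfun_comp d d' (T : measurableType d) (T' : measurableType d') (R : realType)
  (phi : T' -> T) (f : T -> R) :
  measurable_fun [set: T'] phi -> bmfun f -> bmfun (f \o phi).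
Proof.
by move=> mphi [mf [M fM]]; split; [exact: measurableT_comp|exists M => x; exact: fM].
Qed.

Section RealProduct.
Context d1 d2 (T1 : measurableType d1) (T2 : measurableType d2) (R : realType).
Variables (P : probability T1 R) (Q : probability T2 R).

Lemma Rintegral_prod (f : T1 -> R) (g : T2 -> R) : bmfun f -> bmfun g ->
  \int[(P \x Q)%E]_z (f z.1 * g z.2) = \int[P]_x f x * \int[Q]_y g y.
Proof.
move=> bf bg.
have bfg : bmfun (fun z : T1 * T2 => f z.1 * g z.2).
  by apply: bmfunM; [apply: (bmfun_comp measurable_fst bf)|apply: (bmfun_comp measurable_snd bg)].
pose Ig := \int[Q]_y g y.
rewrite {1}/Rintegral -integral12_prod_meas1; last exact: bmfun_integrable bfg.
have -> : (\int[P]_x fubini_F Q (fun z : T1 * T2 => (f z.1 * g z.2)%:E) x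
    = \int[P]_x ((f x)%:E * Ig%:E))%E.
  apply: eq_integral => x _; rewrite /fubini_F /=; under eq_integral do rewrite EFinM.
  rewrite integralZl//; last exact: bmfun_integrable.
  rewrite /Ig /Rintegral fineK//; exact: (integrable_fin_num _ (bmfun_integrable _ bg)).
rewrite integralZr//; last exact: bmfun_integrable.
rewrite fineM//; exact: (integrable_fin_num _ (bmfun_integrable _ bf)).
Qed.
End RealProduct.

Local Notation Re := complex.Re.
Local Notation Im := complex.Im.

Lemma complex_eqP (R : rcfType) (x y : R[i]) : Re x = Re y -> Im x = Im y -> x = y.
Proof. by case: x y => [a b] [a' b'] /= -> ->. Qed.
Lemma ReD (R : rcfType) (x y : R[i]) : Re (x + y) = Re x + Re y.
Proof. by case: x y => [a b] [a' b']. Qed.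
Lemma ImD (R : rcfType) (x y : R[i]) : Im (x + y) = Im x + Im y.
Proof. by case: x y => [a b] [a' b']. Qed.
Lemma ReM (R : rcfType) (x y : R[i]) : Re (x * y) = Re x * Re y - Im x * Im y.
Proof. by case: x y => [a b] [a' b']. Qed.
Lemma ImM (R : rcfType) (x y : R[i]) : Im (x * y) = Re x * Im y + Im x * Re y.
Proof. by case: x y => [a b] [a' b']. Qed.

Section BoundedComplex.
Context d (T : measurableType d) (R : realType).
Implicit Types f g : T -> R[i].

Definition Cbmfun f := bmfun (fun x => Re (f x)) /\ bmfun (fun x => Im (f x)).

Lemma Cbmfun_cst a : Cbmfun (fun=> a).
Proof. by split; apply: bmfun_cst. Qed.

Lemma CbmfunD f g : Cbmfun f -> Cbmfun g -> Cbmfun (fun x => f x + g x).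
Proof.
move=> [f1 f2] [g1 g2]; split.
  by under eq_fun do rewrite ReD; apply: bmfunD.
by under eq_fun do rewrite ImD; apply: bmfunD.
Qed.

Lemma CbmfunM f g : Cbmfun f -> Cbmfun g -> Cbmfun (fun x => f x * g x).
Proof.
move=> [f1 f2] [g1 g2]; split.
  by under eq_fun do rewrite ReM; apply: bmfunB; apply: bmfunM.
by under eq_fun do rewrite ImM; apply: bmfunD; apply: bmfunM.
Qed.

Lemma CbmfunZ a f : Cbmfun f -> Cbmfun (fun x => a * f x).
Proof. by apply: CbmfunM; apply: Cbmfun_cst. Qed.

Lemma CbmfunN f : Cbmfun f -> Cbmfun (fun x => - f x).
Proof. by move=> /(CbmfunZ (-1)); under eq_fun do rewrite mulN1r. Qed.

Lemma CbmfunB f g : Cbmfun f -> Cbmfun g -> Cbmfun (fun x => f x - g x).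
Proof. by move=> cf /CbmfunN; apply: CbmfunD. Qed.

Lemma Cbmfun_sum (I : Type) (s : seq I) (p : pred I) (F : I -> T -> R[i]) :
  (forall i, Cbmfun (F i)) -> Cbmfun (fun x => \sum_(i <- s | p i) F i x).
Proof.
move=> cF; elim: s => [|i s IH].
  by under eq_fun do rewrite big_nil; apply: Cbmfun_cst.
under eq_fun do rewrite big_cons.
by case: (p i) => //; apply: CbmfunD.
Qed.

Lemma Cbmfun_prod (I : Type) (s : seq I) (p : pred I) (F : I -> T -> R[i]) :
  (forall i, Cbmfun (F i)) -> Cbmfun (fun x => \prod_(i <- s | p i) F i x).
Proof.
move=> cF; elim: s => [|i s IH].
  by under eq_fun do rewrite big_nil; apply: Cbmfun_cst.
under eq_fun do rewrite big_cons.
by case: (p i) => //; apply: CbmfunM.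
Qed.

Lemma CbmfunX f k : Cbmfun f -> Cbmfun (fun x => f x ^+ k).
Proof.
move=> cf; elim: k => [|k IH]; first by under eq_fun do rewrite expr0; apply: Cbmfun_cst.
by under eq_fun do rewrite exprS; apply: CbmfunM.
Qed.

Variable P : probability T R.
Local Notation int f := (Cintegral P f).

Lemma CintegralD f g : Cbmfun f -> Cbmfun g -> int (fun x => f x + g x) = int f + int g.
Proof.
move=> [f1 f2] [g1 g2]; rewrite /Cintegral; apply: complex_eqP => /=.
  under eq_Rintegral do rewrite ReD.
  by rewrite RintegralD//; apply: bmfun_integrable.
under eq_Rintegral do rewrite ImD.
by rewrite RintegralD//; apply: bmfun_integrable.
Qed.

Lemma CintegralZ a f : Cbmfun f -> int (fun x => a * f x) = a * int f.
Proof.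
move=> [f1 f2].
have i1 (r : R) : \int[P]_x (r * Re (f x)) = r * \int[P]_x Re (f x).
  by rewrite RintegralZl//; apply: bmfun_integrable.
have i2 (r : R) : \int[P]_x (r * Im (f x)) = r * \int[P]_x Im (f x).
  by rewrite RintegralZl//; apply: bmfun_integrable.
have I1 (r : R) : P.-integrable [set: T] (EFin \o (fun x => r * Re (f x))).
  by apply: bmfun_integrable; apply: bmfunM f1; apply: bmfun_cst.
have I2 (r : R) : P.-integrable [set: T] (EFin \o (fun x => r * Im (f x))).
  by apply: bmfun_integrable; apply: bmfunM f2; apply: bmfun_cst.
apply: complex_eqP; rewrite /Cintegral ?ReM ?ImM /=.
  under eq_Rintegral do rewrite ReM.
  by rewrite RintegralB// i1 i2.
under eq_Rintegral do rewrite ImM.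
by rewrite RintegralD// i1 i2.
Qed.

Lemma CintegralB f g : Cbmfun f -> Cbmfun g -> int (fun x => f x - g x) = int f - int g.
Proof.
move=> cf cg; under eq_fun do rewrite -mulN1r.
by rewrite CintegralD ?CintegralZ ?mulN1r//; apply: CbmfunZ.
Qed.

Lemma Cintegral_cst a : int (fun=> a) = a.
Proof.
have H r : \int[P]_x r = r.
  rewrite Rintegral_cst// -[RHS]mulr1; congr (_ * _).
  exact: (congr1 fine (probability_setT P)).
by rewrite /Cintegral !H; case: a.
Qed.

Lemma Cintegral_sum (I : Type) (s : seq I) (F : I -> T -> R[i]) :
  (forall i, Cbmfun (F i)) -> int (fun x => \sum_(i <- s) F i x) = \sum_(i <- s) int (F i).
Proof.
move=> cF; elim: s => [|i s IH].
  by under eq_fun do rewrite big_nil; rewrite Cintegral_cst big_nil.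
under eq_fun do rewrite big_cons.
by rewrite CintegralD ?big_cons ?IH//; apply: Cbmfun_sum.
Qed.
End BoundedComplex.

Lemma Cbmfun_comp d d' (T : measurableType d) (T' : measurableType d') (R : realType)
  (phi : T' -> T) (f : T -> R[i]) :
  measurable_fun [set: T'] phi -> Cbmfun f -> Cbmfun (fun x => f (phi x)).
Proof. by move=> mphi [f1 f2]; split; [apply: (bmfun_comp mphi f1)|apply: (bmfun_comp mphi f2)]. Qed.

Section ComplexProduct.
Context (R : realType).

Lemma Cintegral_prod d1 d2 (T1 : measurableType d1) (T2 : measurableType d2)
  (P : probability T1 R) (Q : probability T2 R) (f : T1 -> R[i]) (g : T2 -> R[i]) :
  Cbmfun f -> Cbmfun g ->
  Cintegral (P \x Q)%E (fun z => f z.1 * g z.2) = Cintegral P f * Cintegral Q g.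
Proof.
move=> [f1 f2] [g1 g2].
have I (u : T1 -> R) (v : T2 -> R) : bmfun u -> bmfun v ->
    (P \x Q)%E.-integrable [set: T1 * T2] (EFin \o (fun z => u z.1 * v z.2)).
  move=> bu bv; apply: bmfun_integrable.
  by apply: bmfunM; [apply: (bmfun_comp measurable_fst bu)|apply: (bmfun_comp measurable_snd bv)].
apply: complex_eqP; rewrite /Cintegral ?ReM ?ImM /=.
  transitivity (\int[(P \x Q)%E]_z (Re (f z.1) * Re (g z.2) - Im (f z.1) * Im (g z.2))).
    by apply: eq_Rintegral => z _; exact: ReM.
  rewrite RintegralB//; [|exact: (I _ _ f1 g1)|exact: (I _ _ f2 g2)].
  by rewrite (Rintegral_prod P Q f1 g1) (Rintegral_prod P Q f2 g2).
transitivity (\int[(P \x Q)%E]_z (Re (f z.1) * Im (g z.2) + Im (f z.1) * Re (g z.2))).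
  by apply: eq_Rintegral => z _; exact: ImM.
rewrite RintegralD//; [|exact: (I _ _ f1 g2)|exact: (I _ _ f2 g1)].
by rewrite (Rintegral_prod P Q f1 g2) (Rintegral_prod P Q f2 g1).
Qed.

Lemma Cintegral_pushforward d1 d2 (T1 : measurableType d1) (T2 : measurableType d2)
    (P : probability T1 R) (phi : {mfun T1 >-> T2}) (f : T2 -> R[i]) : Cbmfun f ->
  Cintegral (distribution P phi) f = Cintegral P (f \o phi).
Proof.
have H (u : T2 -> R) : bmfun u ->
    \int[distribution P phi]_x u x = \int[P]_x u (phi x).
  move=> bu; rewrite /Rintegral integral_distribution//.
    by apply/measurable_EFinP; case: bu.
  apply: (@bmfun_integrable _ _ _ P (u \o phi)); exact: bmfun_comp bu.
by move=> [f1 f2]; rewrite /Cintegral !H.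
Qed.

Variables (d : measure_display) (T : measurableType d) (P : probability T R).

(** Fubini, by induction along the construction of [power_measure]. *)
Lemma Cintegral_power n (f : 'I_n -> T -> R[i]) : (forall i, Cbmfun (f i)) ->
  Cintegral (power_measure P n) (fun t => \prod_i f i (tnth t i)) =
  \prod_i Cintegral P (f i).
Proof.
move=> cf; have ctn m (j : 'I_m) (g : T -> R[i]) : Cbmfun g ->
    Cbmfun (fun t : m.-tuple T => g (tnth t j)).
  by move=> cg; apply: Cbmfun_comp cg; exact: measurable_tnth.
elim: n f cf => [|n IH] f cf.
  by under eq_fun do rewrite big_ord0; rewrite Cintegral_cst big_ord0.
rewrite /power_measure -/power_measure Cintegral_pushforward; last first.
  by apply: Cbmfun_prod => i; apply: ctn.
rewrite big_ord_recl -IH// -Cintegral_prod//; last first.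
  by apply: Cbmfun_prod => i; apply: ctn.
congr Cintegral; apply/funext => -[x t] /=; rewrite big_ord_recl; congr (_ * _).
by apply: eq_bigr => i _; rewrite tnthS.
Qed.
End ComplexProduct.

(** * Integrals of polynomials depending on a parameter *)

Section PolynomialValued.
Context d (T : measurableType d) (R : realType) (n : nat).
Local Notation poly := (mpoly n R[i]).

(** A polynomial depending on a parameter t through finitely many coefficient
    functions; such families can be integrated coefficientwise. *)
Definition Cbmfun_poly (Q : T -> poly) := exists (I : finType) (a : I -> T -> R[i]) (q : I -> poly),
  (forall i, Cbmfun (a i)) /\ Q = (fun t => \sum_i a i t *: q i).

Lemma Cbmfun_polyZ a q : Cbmfun a -> Cbmfun_poly (fun t => a t *: q).
Proof.
move=> ca; exists unit, (fun=> a), (fun=> q); split => //.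
by apply/funext => t; rewrite big_const card_unit /= addr0.
Qed.

Lemma Cbmfun_poly_cst q : Cbmfun_poly (fun=> q).
Proof.
have -> : (fun=> q) = (fun _ : T => 1 *: q) by apply/funext => t; rewrite scale1r.
by apply: Cbmfun_polyZ; apply: Cbmfun_cst.
Qed.

Lemma Cbmfun_polyD Q1 Q2 : Cbmfun_poly Q1 -> Cbmfun_poly Q2 -> Cbmfun_poly (fun t => Q1 t + Q2 t).
Proof.
move=> [I [a [q [ca ->]]]] [J [b [r [cb ->]]]].
exists (I + J)%type, (fun k => match k with inl i => a i | inr j => b j end),
  (fun k => match k with inl i => q i | inr j => r j end); split; first by case.
by apply/funext => t; rewrite big_sumType.
Qed.

Lemma Cbmfun_polyM Q1 Q2 : Cbmfun_poly Q1 -> Cbmfun_poly Q2 -> Cbmfun_poly (fun t => Q1 t * Q2 t).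
Proof.
move=> [I [a [q [ca ->]]]] [J [b [r [cb ->]]]].
exists (I * J)%type, (fun k t => a k.1 t * b k.2 t), (fun k => q k.1 * r k.2).
split; first by move=> k; apply: CbmfunM.
apply/funext => t; rewrite big_distrlr/= pair_bigA/=; apply: eq_bigr => k _.
by rewrite -scalerAl -scalerAr scalerA.
Qed.

Lemma Cbmfun_polyX Q k : Cbmfun_poly Q -> Cbmfun_poly (fun t => Q t ^+ k).
Proof.
move=> cQ; elim: k => [|k IH]; first by under eq_fun do rewrite expr0; apply: Cbmfun_poly_cst.
by under eq_fun do rewrite exprS; apply: Cbmfun_polyM.
Qed.

Lemma Cbmfun_poly_prod (I : Type) (s : seq I) (p : pred I) (F : I -> T -> poly) :
  (forall i, Cbmfun_poly (F i)) -> Cbmfun_poly (fun x => \prod_(i <- s | p i) F i x).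
Proof.
move=> cF; elim: s => [|i s IH].
  by under eq_fun do rewrite big_nil; apply: Cbmfun_poly_cst.
under eq_fun do rewrite big_cons.
by case: (p i) => //; apply: Cbmfun_polyM.
Qed.

(** A polynomial that is the integral of the Q t at every point is their
    coefficientwise integral, because a polynomial is determined by its values.
    Linear forms commute with the latter. *)
Lemma Cintegral_linear_form (P : probability T R) (L : {scalar poly}) (p : poly) (Q : T -> poly) :
  Cbmfun_poly Q ->
  (forall x, meval x p = Cintegral P (fun t => meval x (Q t))) ->
  L p = Cintegral P (fun t => L (Q t)).
Proof.
move=> [I [a [q [ca ->]]]] pE.
have -> : p = \sum_i Cintegral P (a i) *: q i.
  apply: eq_mpoly_eval => x; rewrite pE raddf_sum/=.
  under eq_fun do rewrite raddf_sum/=.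
  rewrite Cintegral_sum; last by move=> i; under eq_fun do rewrite mevalZ mulrC; apply: CbmfunZ.
  apply: eq_bigr => i _; rewrite mevalZ mulrC -CintegralZ//; congr Cintegral.
  by apply/funext => t; rewrite mevalZ mulrC.
rewrite linear_sum /=; under [in RHS]eq_fun do rewrite linear_sum /=.
have LZ (b : R[i]) i : L (b *: q i) = L (q i) * b by rewrite linearZ /= mulrC.
rewrite Cintegral_sum; last by move=> i; under eq_fun do rewrite LZ; apply: CbmfunZ.
apply: eq_bigr => i _; rewrite LZ -CintegralZ//; congr Cintegral.
by apply/funext => t; rewrite LZ.
Qed.
End PolynomialValued.

(** * Haar measure on SU(2) *)

Section Haar.
Variable R : realType.
Local Notation C := (R[i]).
Implicit Types (g h : su2 R) (i j : 'I_2).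

(** The rows of a unitary matrix have norm 1, hence its entries are bounded by 1.
    This makes the entries bounded functions, and also left multiplication
    Lipschitz in [open_mulmxl]. *)
Lemma su2_sqr_sum g i : \sum_j (g i j) * (g i j)^*%C = 1.
Proof.
have /andP[/unitarymxP gu _] := su2P g.
have := congr1 (fun M : 'M[C]_2 => M i i) gu; rewrite !mxE eqxx mulr1n => <-.
by apply: eq_bigr => j _; rewrite !mxE.
Qed.

Lemma su2_entry_bound g i j : Re (g i j) ^+ 2 + Im (g i j) ^+ 2 <= 1.
Proof.
have := congr1 (fun z : C => Re z) (su2_sqr_sum g i).
rewrite (_ : Re (\sum_j _) = \sum_j (Re (g i j) ^+ 2 + Im (g i j) ^+ 2)); last first.
  by rewrite !big_ord_recl !big_ord0; case: (g _ _) => a b; case: (g _ _) => a' b' /=; ring.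
move=> /= <-; rewrite (bigD1 j)//= lerDl sumr_ge0// => k _.
by rewrite addr_ge0 ?sqr_ge0.
Qed.

Lemma su2_norm_entry g i j : `|g i j| <= 1.
Proof.
by rewrite normc_def -(rmorph1 (real_complex R)) lecR -sqrtr1 ler_sqrt// su2_entry_bound.
Qed.

Lemma Re_bound_su2 g i j : `|Re (g i j)| <= 1.
Proof.
rewrite -(ler_pXn2r (ltn0Sn 1)) ?nnegrE// expr1n real_normK ?num_real//.
by apply: le_trans (su2_entry_bound g i j); rewrite lerDl sqr_ge0.
Qed.

Lemma Im_bound_su2 g i j : `|Im (g i j)| <= 1.
Proof.
rewrite -(ler_pXn2r (ltn0Sn 1)) ?nnegrE// expr1n real_normK ?num_real//.
by apply: le_trans (su2_entry_bound g i j); rewrite lerDr sqr_ge0.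
Qed.

Local Notation Mx := ('M[(C : numFieldType)]_2).

Lemma ltc_norm_Re (z : C) (e : R) : `|z| < e%:C%C -> `|Re z| < e.
Proof. by move=> /(le_lt_trans (normc_ge_Re z)); rewrite ltcR. Qed.

Lemma ltc_norm_Im (z : C) (e : R) : `|z| < e%:C%C -> `|Im z| < e.
Proof.
rewrite normc_def ltcR; apply: le_lt_trans.
by rewrite -sqrtr_sqr ler_sqrt ?addr_ge0 ?sqr_ge0// lerDr sqr_ge0.
Qed.

Lemma open_entry (f : C -> R) i j (x : R) :
  (forall a b (e : R), `|a - b| < e%:C%C -> `|f a - f b| < e) ->
  open [set M : Mx | x < f (M i j)].
Proof.
move=> fcont; rewrite openE => M /= xM.
apply/nbhs_ballP; exists ((f (M i j) - x)%:C%C : C); first by rewrite /= ltcR subr_gt0.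
move=> N [_ /(_ i j)]; rewrite -ball_normE /= => /fcont.
by rewrite ltr_norml => /andP[_]; rewrite ltrD2l ltrN2.
Qed.

Lemma measurable_entry (f : C -> R) i j :
  (forall a b (e : R), `|a - b| < e%:C%C -> `|f a - f b| < e) ->
  measurable_fun [set: su2 R] (fun g => f (g i j)).
Proof.
move=> fcont; apply: (measurability _ (RGenOInfty.measurableE R)) => //.
move=> _ [_ [x ->] <-]; rewrite setTI; apply: sub_sigma_algebra.
exists [set M : Mx | x < f (M i j)]; first exact: open_entry.
by apply/seteqP; split => g /=; rewrite in_itv/= andbT.
Qed.

Lemma Cbmfun_entry i j : Cbmfun (fun g : su2 R => g i j).
Proof.
split; split.
- apply: measurable_entry => a b e; rewrite -[_ - Re b](_ : Re (a - b) = _); first exact: ltc_norm_Re.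
  by case: a b => [? ?] [? ?].
- by exists 1 => g; exact: Re_bound_su2.
- apply: measurable_entry => a b e; rewrite -[_ - Im b](_ : Im (a - b) = _); first exact: ltc_norm_Im.
  by case: a b => [? ?] [? ?].
- by exists 1 => g; exact: Im_bound_su2.
Qed.

(** The entries of h have absolute value at most 1 and rows have two entries, so
    h M and h N are closer than e if M and N are closer than e / 2. *)
Lemma open_mulmxl h (U : set Mx) : open U -> open [set M : Mx | U (h *m M)].
Proof.
rewrite !openE => Uo M /= /Uo /nbhs_ballP[e e0 eU].
apply/nbhs_ballP; exists (e / 2%:R); first by rewrite /= divr_gt0.
move=> N [_ MN]; apply: eU; split => // i j.
rewrite -ball_normE /=.
have -> : (h *m M) i j - (h *m N) i j = \sum_k h i k * (M k j - N k j).
  by rewrite !mxE -sumrB; apply: eq_bigr => k _; rewrite mulrBr.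
apply: le_lt_trans (ler_norm_sum _ _ _) _.
apply: (@lt_le_trans _ _ (\sum_(k < 2) e / 2%:R)); last first.
  by rewrite !big_ord_recl big_ord0 addr0 -splitr.
apply: ltr_sum; first by apply/hasP; exists ord0 => //; rewrite mem_index_enum.
move=> k _; rewrite normrM; have := MN k j; rewrite -ball_normE /= => MNk.
apply: le_lt_trans MNk; rewrite -[leRHS]mul1r ler_wpM2r//.
exact: su2_norm_entry.
Qed.

Definition su2_mull h g : su2 R := (h * g)%g.

Lemma measurable_su2_mull h : measurable_fun [set: su2 R] (su2_mull h).
Proof.
apply: (@measurability _ _ _ _ _ _ (@su2_open R)) => //.
move=> _ [_ [U Uo <-] <-]; rewrite setTI; apply: sub_sigma_algebra.
by exists [set M : Mx | U (h *m M)]; first exact: open_mulmxl.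
Qed.

HB.instance Definition _ h := isMeasurableFun.Build _ _ _ _
  (su2_mull h) (measurable_su2_mull h).

Variables (mu : probability (su2 R) R) (haar_mu : is_haar mu).

Lemma haar_distribution h A : measurable A ->
  distribution mu (su2_mull h) A = mu A.
Proof.
move=> mA; rewrite /distribution/= /pushforward -(haar_mu (h^-1)%g mA); congr (mu _).
apply/seteqP; split => [g /= Ag|_ [g Ag <-]] /=.
  by exists (h * g)%g => //; rewrite mulKg.
by rewrite /su2_mull mulgA mulgV mul1g.
Qed.

Lemma haar_Cintegral h (f : su2 R -> C) : Cbmfun f ->
  Cintegral mu (fun g => f (h * g)%g) = Cintegral mu f.
Proof.
move=> cf; rewrite -[LHS](Cintegral_pushforward mu (su2_mull h) cf).
by apply: complex_eqP; rewrite /Cintegral /= /Rintegral; congr fine;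
   apply: eq_measure_integral => A mA _; apply: haar_distribution.
Qed.
End Haar.

(** * Moments of linear forms in the entries *)

Section LinePoly.
Context d (T : measurableType d) (R : realType) (P : probability T R).
Local Notation C := (R[i]).
Local Notation int f := (Cintegral P f).
Implicit Types (f a b : T -> C).

(** The integral of f (a + t b)^k, expanded in powers of t. Extracting
    coefficients from a family of integrals will always mean comparing this
    polynomial with another one. *)
Definition line_poly f a b k : {poly C} :=
  \poly_(j < k.+1) ('C(k, j)%:R * int (fun x => f x * a x ^+ (k - j) * b x ^+ j)).

Lemma horner_line_poly f a b k t : Cbmfun f -> Cbmfun a -> Cbmfun b ->
  (line_poly f a b k).[t] = int (fun x => f x * (a x + t * b x) ^+ k).
Proof.
move=> cf ca cb; rewrite horner_poly.
have cg (j : 'I_k.+1) : Cbmfun (fun x => f x * a x ^+ (k - j) * b x ^+ j).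
  by apply: CbmfunM (CbmfunX _ cb); apply: CbmfunM (CbmfunX _ ca).
transitivity (\sum_(j < k.+1) int (fun x => ('C(k, j)%:R * t ^+ j) * (f x * a x ^+ (k - j) * b x ^+ j))).
  by apply: eq_bigr => j _; rewrite CintegralZ// mulrAC.
rewrite -Cintegral_sum; last by move=> j; apply: CbmfunZ.
congr Cintegral; apply/funext => x.
rewrite exprDn mulr_sumr; apply: eq_bigr => j _.
by rewrite exprMn -mulr_natl; ring.
Qed.

Lemma coef_line_poly f a b k j : (line_poly f a b k)`_j =
  'C(k, j)%:R * int (fun x => f x * a x ^+ (k - j) * b x ^+ j).
Proof.
by rewrite coef_poly ltnS; case: leqP => // kj; rewrite bin_small// mul0r.
Qed.

Lemma line_poly_eq f a b k (q : {poly C}) : Cbmfun f -> Cbmfun a -> Cbmfun b ->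
  (forall t, int (fun x => f x * (a x + t * b x) ^+ k) = q.[t]) ->
  forall j, 'C(k, j)%:R * int (fun x => f x * a x ^+ (k - j) * b x ^+ j) = q`_j.
Proof.
move=> cf ca cb fq j; rewrite -coef_line_poly (_ : line_poly f a b k = q)//.
by apply: eq_poly_nat => t; rewrite horner_line_poly.
Qed.
End LinePoly.

Section Moments.
Variables (R : realType) (mu : probability (su2 R) R) (haar_mu : is_haar mu).
Local Notation C := (R[i]).
Local Notation int f := (Cintegral mu f).
Implicit Types (g h : su2 R).

(** tr(g N) for the matrix N with rows (A, D) and (B, E). *)
Definition entry_form (A B D E : C) g : C := g 0 0 * A + g 0 1 * B + g 1 0 * D + g 1 1 * E.

Lemma Cbmfun_entry_form A B D E : Cbmfun (entry_form A B D E).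
Proof.
by rewrite /entry_form; do !apply: CbmfunD; apply: CbmfunM; (apply: Cbmfun_entry || apply: Cbmfun_cst).
Qed.

Lemma su2_det g : g 0 0 * g 1 1 - g 0 1 * g 1 0 = 1.
Proof. by rewrite -det_2x2; case/andP: (su2P g) => _ /eqP. Qed.

(** The matrices with rows (p, - q^* ) and (q, p^* ) are the quaternions: the real
    multiples of the elements of SU(2). *)
Definition quaternion_mx (p q : C) : 'M[C]_2 :=
  \matrix_(i, j) (if i == 0 then if j == 0 then p else - q^* else if j == 0 then q else p^*).

Fact quaternion_su2 (p q : C) : p * p^* + q * q^* = 1 ->
  (quaternion_mx p q \is unitarymx) && (\det (quaternion_mx p q) == 1).
Proof.
move=> pq; apply/andP; split; last first.
  by rewrite det_2x2 !mxE /= -pq; apply/eqP; ring.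
apply/unitarymxP/matrixP => i j; rewrite !mxE !big_ord_recl big_ord0 !mxE /=.
case: i => -[|[|//]] ?; case: j => -[|[|//]] ?; rewrite ?mulr1n ?mulr0n -?pq /= ?rmorphN /= ?conjCK; ring.
Qed.

Definition su2_minus_one : su2 R := SU2 (@quaternion_su2 (-1) 0 ltac:(rewrite rmorphN rmorph1; ring)).

Lemma entry_form_opp A B D E g : entry_form A B D E (su2_minus_one * g)%g = - entry_form A B D E g.
Proof.
rewrite /entry_form !mxE !big_ord_recl !big_ord0 !mxE /= !rmorphN !rmorph1 !rmorph0 /=.
have -> : lift 0 0 = 1 :> 'I_2 by apply/val_inj.
ring.
Qed.

(** Translate by -1. *)
Lemma odd_moment0 (f : su2 R -> C) : Cbmfun f ->
  (forall g, f (su2_minus_one * g)%g = - f g) -> int f = 0.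
Proof.
move=> cf fN; have := haar_Cintegral haar_mu su2_minus_one cf.
under eq_fun do rewrite fN -mulN1r; rewrite CintegralZ// mulN1r => /eqP.
by rewrite eq_sym -addr_eq0 -mulr2n mulrn_eq0 => /eqP.
Qed.

Definition moment k A B D E : C := int (fun g => entry_form A B D E g ^+ k).

(** Here N is r h with h in SU(2) and r^2 = det N, so that tr(g N) = r tr(h g),
    and left invariance removes h. The case r = 0 has N = 0. *)
Lemma moment_quaternion s p q :
  moment s.*2 p q (- q^*) p^* = (p * p^* + q * q^*) ^+ s * moment s.*2 1 0 0 1.
Proof.
case: s => [|s].
  by rewrite expr0 mul1r /moment; congr Cintegral; apply/funext => g; rewrite !expr0.
pose r2 := Re p ^+ 2 + Im p ^+ 2 + (Re q ^+ 2 + Im q ^+ 2).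
have r2E : p * p^* + q * q^* = (r2%:C)%C.
  have nE (z : C) : z * z^* = ((Re z ^+ 2 + Im z ^+ 2)%:C)%C.
    by case: z => a b; apply: complex_eqP => /=; ring.
  by rewrite !nE -rmorphD.
have r2_ge0 : 0 <= r2 by rewrite /r2 !addr_ge0 ?sqr_ge0.
pose r : C := (Num.sqrt r2)%:C%C.
have rr : r * r = p * p^* + q * q^* by rewrite r2E -rmorphM -expr2 sqr_sqrtr.
have rJ : r^* = r by exact: conjc_real.
have [r0|rn0] := eqVneq r 0.
  have r20 : r2 = 0.
    by move: rr; rewrite r0 mul0r r2E => /(congr1 (fun z : C => Re z))/= <-.
  have p0 : p = 0.
    move/eqP: r20; rewrite /r2 !paddr_eq0 ?addr_ge0 ?sqr_ge0// !sqrf_eq0.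
    by case/and3P => /andP[/eqP ? /eqP ?] _ _; apply: complex_eqP.
  have q0 : q = 0.
    move/eqP: r20; rewrite /r2 !paddr_eq0 ?addr_ge0 ?sqr_ge0// !sqrf_eq0.
    by case/and3P => _ /eqP ? /eqP ?; apply: complex_eqP.
  rewrite p0 q0 !mul0r addr0 expr0n mul0r /moment.
  under eq_fun do rewrite /entry_form !rmorph0 oppr0 !mulr0 !addr0 expr0n.
  by rewrite Cintegral_cst.
have pq : (p / r) * (p / r)^* + (q / r) * (q / r)^* = 1.
  rewrite !rmorphM /= !fmorphV /= rJ.
  transitivity ((p * p^* + q * q^*) / (r * r)); first by field.
  by rewrite -rr mulfV// mulf_neq0.
pose h : su2 R := SU2 (quaternion_su2 pq).
have hE g : entry_form p q (- q^*) p^* g = r * entry_form 1 0 0 1 (h * g)%g.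
  rewrite /entry_form !mxE !big_ord_recl !big_ord0 !mxE /= !rmorphM /= !fmorphV /= rJ.
  have -> : lift 0 0 = 1 :> 'I_2 by apply/val_inj.
  by field.
rewrite /moment; under eq_fun do rewrite hE exprMn.
have cf : Cbmfun (fun g => entry_form 1 0 0 1 g ^+ s.+1.*2) by apply/CbmfunX/Cbmfun_entry_form.
rewrite CintegralZ.
  by rewrite (haar_Cintegral haar_mu h cf) -addnn exprD -exprMn rr.
exact: Cbmfun_comp (measurable_su2_mull h) cf.
Qed.

(** The complex 2 x 2 matrices are the complexification of the quaternions: this
    decomposes the diagonal entries, and the other two up to a sign. *)
Lemma complex_structure (x y : C) :
  exists p q : C, x = p + 'i%C * q /\ y = p^* + 'i%C * q^*.
Proof.
exists ((x + y^*) / 2%:R), ((x - y^*) / 2%:R * - 'i%C).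
have iJ : ('i%C : C)^* = - 'i%C by apply: complex_eqP => /=; ring.
have ii : 'i%C * 'i%C = -1 :> C by apply: complex_eqP => /=; ring.
have n2 : 2%:R != 0 :> C by rewrite pnatr_eq0.
split.
  transitivity ((x + y^*) / 2%:R - (x - y^*) / 2%:R * ('i%C * 'i%C)); last by ring.
  by rewrite ii; field.
rewrite !rmorphM /= !fmorphV /= (rmorph_nat (Num.conj : C -> C)) rmorphN (rmorphD _ x) (rmorphB _ x) /= !conjCK iJ opprK.
transitivity ((x^* + y) / 2%:R + (x^* - y) / 2%:R * ('i%C * 'i%C)); last by ring.
by rewrite ii; field.
Qed.

(** Write N = P + 'i Q with quaternions P and Q. Both sides, evaluated at P + t Q,
    are polynomials in t; they agree for t real, in particular at the integers,
    hence at t = 'i. *)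
Lemma moment_even s A B D E :
  moment s.*2 A B D E = (A * E - B * D) ^+ s * moment s.*2 1 0 0 1.
Proof.
have [p [p' [AE EE]]] := complex_structure A E.
have [q [q' [BE DE]]] := complex_structure B (- D).
pose cst := moment s.*2 1 0 0 1.
pose Q : {poly C} := cst *: ((p%:P + p' *: 'X) * ((p^*)%:P + (p'^*) *: 'X)
  + (q%:P + q' *: 'X) * ((q^*)%:P + (q'^*) *: 'X)) ^+ s.
have QE : line_poly mu (fun=> 1) (entry_form p q (- q^*) p^*) (entry_form p' q' (- q'^*) p'^*) s.*2 = Q.
  apply: eq_poly_nat => k; rewrite horner_line_poly; try exact: Cbmfun_entry_form; last exact: Cbmfun_cst.
  transitivity (moment s.*2 (p + k%:R * p') (q + k%:R * q') (- (q + k%:R * q')^*) (p + k%:R * p')^*).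
    congr Cintegral; apply/funext => g; rewrite mul1r /entry_form !rmorphD !rmorphM !rmorph_nat.
    by congr (_ ^+ _); ring.
  rewrite moment_quaternion /Q !hornerE /= mulrC -/cst; congr (_ * _ ^+ _).
  by rewrite !rmorphD !rmorphM !rmorph_nat; ring.
have := congr1 (fun P => P.['i%C]) QE; rewrite horner_line_poly; try exact: Cbmfun_entry_form; last exact: Cbmfun_cst.
rewrite /Q !hornerE /= -/cst mulrC => H.
rewrite [D](_ : D = - q^* + 'i%C * - q'^*); last by rewrite -[LHS]opprK DE; ring.
rewrite AE BE EE.
transitivity (int (fun g => 1 * (entry_form p q (- q^*) p^* g + 'i%C * entry_form p' q' (- q'^*) p'^* g) ^+ s.*2)).
  congr Cintegral; apply/funext => g; rewrite mul1r /entry_form; congr (_ ^+ _); ring.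
by rewrite H; congr (_ ^+ _ * _); ring.
Qed.
End Moments.

Lemma coef_linear_exp (K : comNzRingType) (x y : K) k j :
  ((x%:P + y *: 'X) ^+ k)`_j = 'C(k, j)%:R * (x ^+ (k - j) * y ^+ j).
Proof.
rewrite exprDn coef_sum.
have E (i : 'I_k.+1) : ((x%:P ^+ (k - i) * (y *: 'X) ^+ i) *+ 'C(k, i))`_j
   = (if i == j :> nat then 'C(k, j)%:R * (x ^+ (k - j) * y ^+ j) else 0).
  rewrite coefMn -rmorphXn /= exprZn coefCM coefZ coefXn (eq_sym j).
  by case: eqP => [->|_]; rewrite ?mulr1 ?mulr0 ?mul0rn// mulr_natl.
under eq_bigr do rewrite E.
have [jk|kj] := leqP j k.
  rewrite (bigD1 (Ordinal (jk : (j < k.+1)%N)))//= eqxx big1 ?addr0// => i ij.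
  by rewrite ifN.
rewrite bin_small// mul0r big1// => i _.
by rewrite ifN//; apply: contraL (ltn_ord i) => /eqP ->; rewrite -leqNgt.
Qed.

Section Catalan.
Variables (R : realType) (mu : probability (su2 R) R) (haar_mu : is_haar mu).
Local Notation C := (R[i]).
Local Notation int f := (Cintegral mu f).
Implicit Types (g h : su2 R).
Local Notation a g := (su2_mx g 0 0).
Local Notation b g := (su2_mx g 0 1).
Local Notation c g := (su2_mx g 1 0).
Local Notation d g := (su2_mx g 1 1).

Let ca : Cbmfun (fun g => a g). Proof. exact: Cbmfun_entry. Qed.
Let cb : Cbmfun (fun g => b g). Proof. exact: Cbmfun_entry. Qed.
Let cc : Cbmfun (fun g => c g). Proof. exact: Cbmfun_entry. Qed.
Let cd : Cbmfun (fun g => d g). Proof. exact: Cbmfun_entry. Qed.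
Let c1 : Cbmfun (fun g : su2 R => 1 : C). Proof. exact: Cbmfun_cst. Qed.
Let cat s := moment mu s.*2 1 0 0 1.

(* The coefficient of t^s in the moment of a t + d, where N is diagonal. *)
Let diag_moment s : 'C(s.*2, s)%:R * int (fun g => a g ^+ s * d g ^+ s) = cat s.
Proof.
have H t : int (fun g => 1 * (d g + t * a g) ^+ s.*2) = (cat s *: 'X^s).[t].
  rewrite !hornerE /=.
  transitivity (moment mu s.*2 t 0 0 1).
    by congr Cintegral; apply/funext => g; rewrite mul1r /entry_form; congr (_ ^+ _); ring.
  by rewrite moment_even// mulr1 mul0r subr0 mulrC.
have := line_poly_eq c1 cd ca H s; rewrite coefZ coefXn eqxx mulr1 => <-.
congr (_ * Cintegral _ _); apply/funext => g.
by rewrite mul1r mulrC -addnn addnK.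
Qed.

(* The moment of x a + y b + z c + d is a multiple of (x - y z)^(s+1). Take the
   coefficient of x^s, then of y, then of z. *)
Let antidiag_moment s :
  ('C(s.+1.*2, s) * s.+2)%:R * int (fun g => a g ^+ s * d g ^+ s * b g * c g)
   = - cat s.+1.
Proof.
have H x y z : int (fun g => 1 * ((d g + y * b g + z * c g) + x * a g) ^+ s.+1.*2)
    = (cat s.+1 *: ((- (y * z))%:P + 1 *: 'X) ^+ s.+1).[x].
  rewrite !hornerE /=.
  transitivity (moment mu s.+1.*2 x y z 1).
    by congr Cintegral; apply/funext => g; rewrite mul1r /entry_form; congr (_ ^+ _); ring.
  by rewrite moment_even// mulr1 mulrC ?mul1r [in RHS]addrC.
have cyz y z : Cbmfun (fun g => d g + y * b g + z * c g).
  by apply: CbmfunD; [apply: CbmfunD => //|]; apply: CbmfunZ.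
have H1 y z := line_poly_eq c1 (cyz y z) ca (fun x => H x y z) s.
have E1 y z : int (fun g => (a g ^+ s *+ 'C(s.+1.*2, s)) * (d g + z * c g + y * b g) ^+ s.+2) =
   ((- (cat s.+1 * s.+1%:R * z)) *: 'X).[y].
  rewrite !hornerE.
  transitivity ((cat s.+1 *: ((- (y * z))%:P + 1 *: 'X) ^+ s.+1)`_s).
    rewrite -H1 -CintegralZ; last first.
      by apply: CbmfunM; [apply: CbmfunM => //; apply: CbmfunX|apply: CbmfunX].
    congr Cintegral; apply/funext => g.
    rewrite mul1r (_ : s.+1.*2 - s = s.+2)%N; last by lia.
    rewrite [d g + _ + _]addrAC -mulr_natl; ring.
  by rewrite coefZ coef_linear_exp subSn// subnn expr1n binSn; ring.
have cas : Cbmfun (fun g => a g ^+ s *+ 'C(s.+1.*2, s)).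
  by under eq_fun do rewrite -mulr_natl; apply: CbmfunZ; apply: CbmfunX.
have cz z : Cbmfun (fun g => d g + z * c g) by apply: CbmfunD => //; apply: CbmfunZ.
have E2 z : int (fun g => (a g ^+ s * b g *+ ('C(s.+1.*2, s) * s.+2)) * (d g + z * c g) ^+ s.+1) =
   ((- (cat s.+1 * s.+1%:R)) *: 'X).[z].
  have := line_poly_eq cas (cz z) cb (fun y => E1 y z) 1.
  rewrite !hornerE coefZ coefX mulr1 bin1 => E; rewrite mulNr -E -CintegralZ; last first.
    by apply: CbmfunM; [apply: CbmfunM => //; apply: CbmfunX|apply: CbmfunX].
  congr Cintegral; apply/funext => g.
  by rewrite expr1 subn1 /= -!(mulr_natl (_ * b g)) -mulr_natl natrM; ring.
have cas2 : Cbmfun (fun g => a g ^+ s * b g *+ ('C(s.+1.*2, s) * s.+2)).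
  by under eq_fun do rewrite -mulr_natl; apply: CbmfunZ; apply: CbmfunM => //; apply: CbmfunX.
have := line_poly_eq cas2 cd cc E2 1.
rewrite coefZ coefX mulr1 bin1 => E.
apply: (@mulfI _ s.+1%:R); first by rewrite pnatr_eq0.
rewrite [RHS]mulrN [in RHS]mulrC -E; congr (_ * _).
rewrite -CintegralZ; last first.
  by do !apply: CbmfunM => //; apply: CbmfunX.
congr Cintegral; apply/funext => g.
by rewrite expr1 subn1 /= -(mulr_natl (_ * b g)); ring.
Qed.

(* By a d - b c = 1, the integral of a^s d^s is the difference of the two moments
   just computed, at s + 1. Both are known multiples of the Catalan constant, and
   this gives the recurrence (s + 2) I_(s+1) = (s + 1) I_s. *)
Let diag_int s : int (fun g => a g ^+ s * d g ^+ s) = s.+1%:R^-1.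
Proof.
elim: s => [|s IH].
  by under eq_fun do rewrite mul1r; rewrite Cintegral_cst invr1.
have n0 k : k.+1%:R != 0 :> C by rewrite pnatr_eq0.
have B0 : 'C(s.+1.*2, s.+1)%:R != 0 :> C.
  by rewrite pnatr_eq0 -lt0n bin_gt0 -addnn leq_addr.
have B1 : 'C(s.+1.*2, s)%:R * s.+2%:R = 'C(s.+1.*2, s.+1)%:R * s.+1%:R :> C.
  rewrite -!natrM; congr _%:R; rewrite [RHS]mulnC mul_bin_left mulnC; congr (_ * _)%N; lia.
have := antidiag_moment s; rewrite -diag_moment natrM B1.
move=> /eqP; rewrite -mulrA -mulrN (inj_eq (mulfI B0)) => /eqP E.
have c2 : Cbmfun (fun g => a g ^+ s.+1 * d g ^+ s.+1) by apply: CbmfunM; apply: CbmfunX.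
have c3 : Cbmfun (fun g => a g ^+ s * d g ^+ s * b g * c g).
  by do !apply: CbmfunM => //; apply: CbmfunX.
have F : int (fun g => a g ^+ s.+1 * d g ^+ s.+1) - int (fun g => a g ^+ s * d g ^+ s * b g * c g) = s.+1%:R^-1.
  rewrite -IH -CintegralB//; congr Cintegral; apply/funext => g.
  by rewrite -[RHS]mulr1 -(su2_det g) !exprS; ring.
apply: (@mulfI _ s.+2%:R) => //; rewrite mulfV//.
move: E F; set W := int _; set X := int _ => E F.
transitivity (s.+1%:R * (X - W)); last by rewrite F mulfV.
by rewrite mulrBr E (natrD _ 1 s.+1); ring.
Qed.

(** The Catalan numbers: the even moments of the trace. *)
Lemma catalan_moment s : cat s = 'C(s.*2, s)%:R / s.+1%:R.
Proof. by rewrite -diag_moment diag_int. Qed.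
End Catalan.

(** * The integral at a vertex *)

Section Vertex.
Variables (R : realType) (mu : probability (su2 R) R) (haar_mu : is_haar mu).
Local Notation C := (R[i]).
Local Notation int f := (Cintegral mu f).
Implicit Types (g h : su2 R).

(** omega((x, y), g (x', y')). *)
Definition su2_form (x y x' y' : C) g : C :=
  x * (g 1 0 * x' + g 1 1 * y') - y * (g 0 0 * x' + g 0 1 * y').

Lemma su2_formE x y x' y' g :
  su2_form x y x' y' g = entry_form (- (y * x')) (- (y * y')) (x * x') (x * y') g.
Proof. by rewrite /su2_form /entry_form; ring. Qed.

Lemma Cbmfun_su2_form x y x' y' : Cbmfun (su2_form x y x' y').
Proof.
have -> : su2_form x y x' y' = entry_form (- (y * x')) (- (y * y')) (x * x') (x * y').
  by apply/funext => g; exact: su2_formE.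
exact: Cbmfun_entry_form.
Qed.

(** The polynomial epsilon at a vertex, as a function of the values of its
    variables. *)
Definition bracket_product (a b c : nat) (x1 y1 x2 y2 x3 y3 : C) : C :=
  (x2 * y1 - x1 * y2) ^+ ((a + b - c)./2)%N
  * (x3 * y2 - x2 * y3) ^+ ((b + c - a)./2)%N
  * (x3 * y1 - x1 * y3) ^+ ((a + c - b)./2)%N.

(** Apply [moment_even] to N = N_1 + t_2 N_2 + t_3 N_3, where omega(u_i, g u'_i)
    is tr(g N_i), so that each N_i has rank one and
    det N = t_2 d_12 + t_3 d_13 + t_2 t_3 d_23.
    By homogeneity t_1 = 1 is no loss. The coefficient of t_3^c is that of
    (t_2 d_12 + t_3 (d_13 + t_2 d_23))^s, which a single binomial gives, and the
    coefficient of t_2^b in the result a second one. The exponents of the d_ij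
    are then those of epsilon, the binomials vanish exactly when the triangle
    inequalities fail, and the quotient of all factorials is the theta value. *)
Lemma vertex_integral a b c x1 y1 x2 y2 x3 y3 x1' y1' x2' y2' x3' y3' :
  int (fun g => su2_form x1 y1 x1' y1' g ^+ a * su2_form x2 y2 x2' y2' g ^+ b
                * su2_form x3 y3 x3' y3' g ^+ c) =
  (if admissible_triple a b c then (theta C a b c)^-1 else 0)
  * (bracket_product a b c x1 y1 x2 y2 x3 y3
     * bracket_product a b c x1' y1' x2' y2' x3' y3').
Proof.
set f1 := su2_form x1 y1 x1' y1'; set f2 := su2_form x2 y2 x2' y2'.
set f3 := su2_form x3 y3 x3' y3'.
have c1 : Cbmfun f1 by exact: Cbmfun_su2_form.
have c2 : Cbmfun f2 by exact: Cbmfun_su2_form.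
have c3 : Cbmfun f3 by exact: Cbmfun_su2_form.
have [odd_abc|even_abc] := boolP (odd (a + b + c)).
  rewrite /admissible_triple odd_abc /= mul0r; apply: (odd_moment0 haar_mu).
    by apply: CbmfunM (CbmfunX _ c3); apply: CbmfunM; apply: CbmfunX.
  move=> g; rewrite /f1 /f2 /f3 !su2_formE !entry_form_opp.
  rewrite (exprNn _ a) (exprNn _ b) (exprNn _ c).
  have s1 : (-1) ^+ (a + b + c) = -1 :> C by rewrite -signr_odd odd_abc expr1.
  by rewrite -[RHS]mulN1r -[X in _ = X * _]s1 !exprD; ring.
pose s := (a + b + c)./2.
have sE : (a + b + c)%N = s.*2 by rewrite /s halfK (negbTE even_abc) subn0.
pose d12 := (x2 * y1 - x1 * y2) * (x2' * y1' - x1' * y2').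
pose d23 := (x3 * y2 - x2 * y3) * (x3' * y2' - x2' * y3').
pose d13 := (x3 * y1 - x1 * y3) * (x3' * y1' - x1' * y3').
pose cat : C := 'C(s.*2, s)%:R / s.+1%:R.
have hornE u v t : (cat *: (u%:P + v *: 'X) ^+ s).[t] = cat * (u + v * t) ^+ s.
  by rewrite !hornerE.
have hornE2 (k u v t : C) m : (k *: ('X ^+ m * (u%:P + v *: 'X) ^+ c)).[t] = k * (t ^+ m * (u + v * t) ^+ c).
  by rewrite hornerZ hornerM !horner_exp !hornerE.
have H t2 t3 : int (fun g => 1 * ((f1 g + t2 * f2 g) + t3 * f3 g) ^+ s.*2) =
   (cat *: ((t2 * d12)%:P + (d13 + t2 * d23) *: 'X) ^+ s).[t3].
  pose m u v w := - (y1 * u) + t2 * - (y2 * v) + t3 * - (y3 * w) : C.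
  pose m' u v w := x1 * u + t2 * (x2 * v) + t3 * (x3 * w) : C.
  transitivity (moment mu s.*2 (m x1' x2' x3') (m y1' y2' y3') (m' x1' x2' x3') (m' y1' y2' y3')).
    congr Cintegral; apply/funext => g; rewrite mul1r /f1 /f2 /f3 !su2_formE /entry_form /m /m'.
    by congr (_ ^+ _); ring.
  rewrite (moment_even haar_mu) catalan_moment// hornE mulrC; congr (_ * _ ^+ _).
  by rewrite /m /m' /d12 /d13 /d23; ring.
have cf t2 : Cbmfun (fun g => f1 g + t2 * f2 g) by apply: CbmfunD => //; apply: CbmfunZ.
have c0 : Cbmfun (fun g : su2 R => 1 : C) by exact: Cbmfun_cst.
have c3c : Cbmfun (fun g => f3 g ^+ c *+ 'C(s.*2, c)).
  by under eq_fun do rewrite -mulr_natl; apply: CbmfunZ; apply: CbmfunX.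
have H2 t2 : int (fun g => (f3 g ^+ c *+ 'C(s.*2, c)) * (f1 g + t2 * f2 g) ^+ (a + b)) =
   ((cat * 'C(s, c)%:R * d12 ^+ (s - c)) *: ('X ^+ (s - c) * (d13%:P + d23 *: 'X) ^+ c)).[t2].
  have := line_poly_eq c0 (cf t2) c3 (H t2) c.
  rewrite coefZ coef_linear_exp -CintegralZ; last first.
    by apply: CbmfunM; [apply: CbmfunM => //|]; apply: CbmfunX.
  move=> E; transitivity (cat * ('C(s, c)%:R * ((t2 * d12) ^+ (s - c) * (d13 + t2 * d23) ^+ c))).
    rewrite -E; congr Cintegral; apply/funext => g.
    by rewrite mul1r -sE addnK -mulr_natl; ring.
  by rewrite hornE2 exprMn [d23 * t2]mulrC; ring.
have := line_poly_eq c3c c1 c2 H2 b.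
rewrite addnK coefZ coefXnM coef_linear_exp -CintegralZ; last first.
  by apply: CbmfunM; [apply: CbmfunM => //|]; apply: CbmfunX.
have -> : (fun g => 'C(a + b, b)%:R * (f3 g ^+ c *+ 'C(s.*2, c) * f1 g ^+ a * f2 g ^+ b))
  = (fun g => ('C(a + b, b) * 'C(s.*2, c))%:R * (f1 g ^+ a * f2 g ^+ b * f3 g ^+ c)).
  by apply/funext => g; rewrite -mulr_natl natrM; ring.
rewrite CintegralZ; last by apply: CbmfunM (CbmfunX _ c3); apply: CbmfunM; apply: CbmfunX.
move=> E.
have B0 : ('C(a + b, b) * 'C(s.*2, c))%:R != 0 :> C.
  by rewrite pnatr_eq0 -lt0n muln_gt0 !bin_gt0 leq_addl -sE leq_addl.
apply: (mulfI B0); rewrite {}E.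
rewrite /admissible_triple even_abc /=.
(* s is half of a + b + c, so a triangle inequality fails when one of a, b, c
   exceeds s; each case kills one of the factors. *)
have [/and3P[abc bac cab]|nadm] := boolP [&& a <= b + c, b <= a + c & c <= a + b]%N; last first.
  rewrite mul0r mulr0; have [cs|sc] := leqP c s; last by rewrite (bin_small sc) mulr0 !mul0r.
  case: ltnP => [_|scb]; first by rewrite mulr0.
  by rewrite (@bin_small c) ?mul0r ?mulr0//; move: nadm; rewrite !negb_and -!ltnNge; lia.
have [p [q [r [aE bE cE]]]] : exists p q r, [/\ a = p + r, b = p + q & c = q + r]%N.
  by exists (s - c)%N, (s - a)%N, (s - b)%N; split; lia.
have pE : (s - c = p)%N by lia.
have qE : (b - p = q)%N by lia.
have rE : (c - q = r)%N by lia.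
have hp : ((a + b - c)./2 = p)%N by rewrite (_ : (_ - _)%N = p.*2) ?doubleK//; lia.
have hq : ((b + c - a)./2 = q)%N by rewrite (_ : (_ - _)%N = q.*2) ?doubleK//; lia.
have hr : ((a + c - b)./2 = r)%N by rewrite (_ : (_ - _)%N = r.*2) ?doubleK//; lia.
rewrite pE qE rE ltnNge bE leq_addr /= -bE /bracket_product /theta hp hq hr -/s.
set t := (_ / _)^-1.
suff tE : cat * 'C(s, c)%:R * 'C(c, q)%:R = ('C(a + b, b) * 'C(s.*2, c))%:R * t.
  rewrite [RHS]mulrA -tE /d12 /d13 /d23 !exprMn; ring.
rewrite /t /cat invf_div -mulrA mulrAC [RHS]mulrA -!natrM; apply/eqP.
rewrite eqr_div ?pnatr_eq0 -?lt0n ?muln_gt0 ?fact_gt0// -!natrM eqr_nat; apply/eqP.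
have f1E := bin_fact (leq_addl s s); rewrite addnK addnn in f1E.
have f2E := @bin_fact s c; rewrite pE in f2E; have {}f2E := f2E ltac:(lia).
have f3E := @bin_fact c q; rewrite rE in f3E; have {}f3E := f3E ltac:(lia).
have f4E := bin_fact (leq_addl a b); rewrite addnK in f4E.
have f5E := bin_fact (leq_addl (a + b) c); rewrite addnK sE in f5E.
rewrite factS; move: f1E f2E f3E f4E f5E.
move: ('C(s.*2, s)) ('C(s, c)) ('C(c, q)) ('C(a + b, b)) ('C(s.*2, c)) => v1 v2 v3 v4 v5.
move: (s.*2)`! (a + b)`! s`! c`! p`! q`! r`! a`! b`! => F2s Fab Fs Fc Fp Fq Fr Fa Fb.
move=> E1 E2 E3 E4 E5.
transitivity (F2s * s.+1)%N.
  transitivity (v1 * (Fs * (v2 * (v3 * (Fq * Fr) * Fp))) * s.+1)%N; first by ring.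
  by rewrite E3 E2 E1.
transitivity (v5 * (Fc * (v4 * (Fb * Fa))) * s.+1)%N; first by rewrite E4 E5.
by ring.
Qed.
End Vertex.

(** * Gluing the vertices along the edges *)

Lemma invmx_2x2 (K : fieldType) (A : 'M[K]_2) : \det A = 1 ->
  [/\ invmx A 0 0 = A 1 1, invmx A 0 1 = - A 0 1, invmx A 1 0 = - A 1 0 & invmx A 1 1 = A 0 0].
Proof.
move=> dA; pose B : 'M[K]_2 := \matrix_(i, j)
  (if i == 0 then if j == 0 then A 1 1 else - A 0 1 else if j == 0 then - A 1 0 else A 0 0).
have AB : A *m B = 1%:M.
  apply/matrixP => i j; rewrite !mxE !big_ord_recl big_ord0 !mxE /= -dA det_2x2.
  have -> : lift 0 0 = 1 :> 'I_2 by apply/val_inj.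
  case: i => -[|[|//]] i2; case: j => -[|[|//]] j2; rewrite ?mulr1n ?mulr0n /=.
  - have -> : Ordinal i2 = 0 by apply/val_inj. ring.
  - have -> : Ordinal i2 = 0 by apply/val_inj. ring.
  - have -> : Ordinal i2 = 1 by apply/val_inj. ring.
  - have -> : Ordinal i2 = 1 by apply/val_inj. ring.
have uA : A \in unitmx by rewrite unitmxE dA unitr1.
have -> : invmx A = B by rewrite -[RHS](mulKmx uA) AB mulmx1.
by rewrite !mxE.
Qed.

Lemma meval_exp n (K : comNzRingType) (x : 'I_n -> K) (p : mpoly n K) k :
  meval x (p ^+ k) = meval x p ^+ k.
Proof. exact: rmorphXn. Qed.

Lemma meval_bracket n (K : comNzRingType) (x : 'I_n -> K) (z1 w1 z2 w2 z3 w3 : mpoly n K) i j k :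
  meval x ((z2 * w1 - z1 * w2) ^+ i * (z3 * w2 - z2 * w3) ^+ j * (z3 * w1 - z1 * w3) ^+ k) =
  (meval x z2 * meval x w1 - meval x z1 * meval x w2) ^+ i
  * (meval x z3 * meval x w2 - meval x z2 * meval x w3) ^+ j
  * (meval x z3 * meval x w1 - meval x z1 * meval x w3) ^+ k.
Proof. by rewrite 2!mevalM !meval_exp !mevalB !mevalM. Qed.

Lemma admissible_triple_rot a b c : admissible_triple a b c = admissible_triple b c a.
Proof.
rewrite /admissible_triple (_ : a + b + c = b + c + a)%N; last by lia.
by case: (odd _) => //=; rewrite [(c + a)%N]addnC [(b + a)%N]addnC; do 3!case: (_ <= _)%N.
Qed.

Section Graph.
Variables (Gamma : trivalent_graph) (le : rel (halfedge Gamma)).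
Hypothesis le_order : half_edge_order le.

Lemma halves_atP v : exists h, halves_at le v = [:: h; nxt h; nxt (nxt h)].
Proof. by case: le_order. Qed.

Lemma mem_halves_at v h : (h \in halves_at le v) = (hvertex h == v).
Proof. by rewrite /halves_at mem_sort mem_enum inE. Qed.

Lemma prod_halves_at (K : comPzRingType) v (F : halfedge Gamma -> K) :
  \prod_(h | hvertex h == v) F h = \prod_(h <- halves_at le v) F h.
Proof.
rewrite /halves_at [RHS](perm_big (enum [set h | hvertex h == v]%SET)) /=; last by rewrite perm_sort.
by rewrite big_enum /=; apply: eq_bigl => h; rewrite inE.
Qed.

Lemma prod_halves_of (K : comPzRingType) e (F : halfedge Gamma -> K) :
  \prod_(h | hedge h == e) F h = \prod_(h <- halves_of le e) F h.
Proof.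
rewrite /halves_of [RHS](perm_big (enum [set h | hedge h == e]%SET)) /=; last by rewrite perm_sort.
by rewrite big_enum /=; apply: eq_bigl => h; rewrite inE.
Qed.

Definition vertex_admissible (c : edge Gamma -> nat) v : bool :=
  if halves_at le v is [:: h1; h2; h3] then
    admissible_triple (c (hedge h1)) (c (hedge h2)) (c (hedge h3)) else true.

Lemma admissibleE c : admissible c = [forall v, vertex_admissible c v].
Proof.
apply/forallP/forallP => [H v|H h].
  by rewrite /vertex_admissible; have [h ->] := halves_atP v; apply: H.
have [h' E] := halves_atP (hvertex h).
have := H (hvertex h); rewrite /vertex_admissible E => adm.
have : h \in halves_at le (hvertex h) by rewrite mem_halves_at.
rewrite E !inE => /or3P[] /eqP -> //; rewrite ?nxt3 //.
  by rewrite -admissible_triple_rot.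
by rewrite admissible_triple_rot.
Qed.
End Graph.

Section Assembly.
Variables (R : realType) (Gamma : trivalent_graph) (le : rel (halfedge Gamma)).
Hypothesis le_order : half_edge_order le.
Local Notation C := (R[i]).
Variables (psi : halfedge Gamma -> 'M[C]_2) (det_psi : forall h, \det (psi h) = 1).
Variables (mu : probability (su2 R) R) (haar_mu : is_haar mu).
Variable (c : edge Gamma -> nat).
Local Notation nvar := #|{: halfedge Gamma * bool}|.
Local Notation nV := #|vertex Gamma|.
Local Notation tup := (nV.-tuple (su2 R)).
Local Notation int f := (Cintegral (power_measure mu nV) f).
Implicit Types (v : vertex Gamma) (e : edge Gamma) (h : halfedge Gamma) (x y : 'I_nvar -> C)
  (t : tup).

Definition hol t h : 'M[C]_2 :=
  psi h *m su2_mx (tnth t (enum_rank (hvertex h))) *m invmx (psi h).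

Definition hol_z t y h : C := hol t h 0 0 * y (zidx h) + hol t h 0 1 * y (widx h).
Definition hol_w t y h : C := hol t h 1 0 * y (zidx h) + hol t h 1 1 * y (widx h).

(** omega(psi_h^-1 x_h, g psi_h^-1 y_h): the substitution in epsilon is by the
    inverse of psi, on both sides of g. *)
Definition halfedge_form x y h (g : su2 R) : C :=
  su2_form (meval x (zpsi psi h)) (meval x (wpsi psi h))
           (meval y (zpsi psi h)) (meval y (wpsi psi h)) g.

Lemma meval_zpsi x h : meval x (zpsi psi h) =
  invmx (psi h) 0 0 * x (zidx h) + invmx (psi h) 0 1 * x (widx h).
Proof. by rewrite /zpsi mevalD !mevalZ !mevalXU. Qed.

Lemma meval_wpsi x h : meval x (wpsi psi h) =
  invmx (psi h) 1 0 * x (zidx h) + invmx (psi h) 1 1 * x (widx h).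
Proof. by rewrite /wpsi mevalD !mevalZ !mevalXU. Qed.

Lemma mulmx_2x2 (A B : 'M[C]_2) i j : (A *m B) i j = A i 0 * B 0 j + A i 1 * B 1 j.
Proof.
rewrite !mxE !big_ord_recl big_ord0 addr0.
by have -> : lift 0 0 = 1 :> 'I_2 by apply/val_inj.
Qed.

(** psi_h preserves omega, so it can be moved to the other argument; this brings
    out the conjugate of g that occurs in the theorem. *)
Lemma halfedge_formE x y h t : halfedge_form x y h (tnth t (enum_rank (hvertex h))) =
  x (zidx h) * hol_w t y h - x (widx h) * hol_z t y h.
Proof.
rewrite /halfedge_form /su2_form !meval_zpsi !meval_wpsi /hol_w /hol_z /hol !mulmx_2x2.
by have [-> -> -> ->] := invmx_2x2 (det_psi h); ring.
Qed.

Lemma det_hol t h : \det (hol t h) = 1.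
Proof.
rewrite /hol !det_mulmx det_inv det_psi invr1 mulr1 mul1r.
by case/andP: (su2P (tnth t (enum_rank (hvertex h)))) => _ /eqP.
Qed.

(** Extended by 0 to triples that are not admissible, so that the sequel treats
    all colorings alike. *)
Definition vertex_weight v : C :=
  if halves_at le v is [:: h1; h2; h3] then
    if admissible_triple (hcol c h1) (hcol c h2) (hcol c h3)
    then (theta C (hcol c h1) (hcol c h2) (hcol c h3))^-1 else 0
  else 1.

Lemma vertex_integral_halfedge_form v x y :
  Cintegral mu (fun g => \prod_(h | hvertex h == v) halfedge_form x y h g ^+ hcol c h) =
  vertex_weight v * (meval x (epsilon le psi c v) * meval y (epsilon le psi c v)).
Proof.
rewrite /vertex_weight /epsilon; have [h E] := halves_atP le_order v; rewrite E.
transitivity (Cintegral mu (fun g => halfedge_form x y h g ^+ hcol c h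
    * halfedge_form x y (nxt h) g ^+ hcol c (nxt h)
    * halfedge_form x y (nxt (nxt h)) g ^+ hcol c (nxt (nxt h)))).
  congr Cintegral; apply/funext => g.
  by rewrite (@prod_halves_at _ le C v) E 2!big_cons big_seq1; exact: mulrA.
rewrite 2!meval_bracket; exact: (vertex_integral haar_mu).
Qed.

Lemma graph_integral x y :
  \prod_v (vertex_weight v * (meval x (epsilon le psi c v) * meval y (epsilon le psi c v))) =
  int (fun t => \prod_h halfedge_form x y h (tnth t (enum_rank (hvertex h))) ^+ hcol c h).
Proof.
under eq_bigr do rewrite -vertex_integral_halfedge_form.
pose F (i : 'I_nV) g := \prod_(h | hvertex h == enum_val i) halfedge_form x y h g ^+ hcol c h.
transitivity (\prod_i Cintegral mu (F i)).
  rewrite (reindex _ (onW_bij _ (@enum_rank_bij _)))/=; apply: eq_bigr => v _.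
  by rewrite /F enum_rankK.
rewrite -Cintegral_power; last first.
  by move=> i; apply: Cbmfun_prod => h; apply: CbmfunX; apply: Cbmfun_su2_form.
congr Cintegral; apply/funext => t.
rewrite (reindex _ (onW_bij _ (@enum_rank_bij _)))/=.
rewrite (partition_big (@hvertex Gamma) xpredT)//=; apply: eq_bigr => v _.
by rewrite /F enum_rankK; apply: eq_bigr => h /eqP ->.
Qed.
Variables (e1 e2 : edge Gamma -> halfedge Gamma).
Hypothesis halves_ofE : forall e, halves_of le e = [:: e1 e; e2 e].

Lemma meval_edge_form x al be ga de e :
  meval x (edge_form le al be ga de e : mpoly nvar C) =
    al e * (x (zidx (e1 e)) * x (zidx (e2 e))) + be e * (x (zidx (e1 e)) * x (widx (e2 e)))
    + ga e * (x (widx (e1 e)) * x (zidx (e2 e))) + de e * (x (widx (e1 e)) * x (widx (e2 e))).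
Proof.
by rewrite /edge_form halves_ofE !mevalD !mevalZ !mevalM !mevalXU.
Qed.

Lemma meval_prod (I : Type) (s : seq I) x (F : I -> mpoly nvar C) :
  meval x (\prod_(i <- s) F i) = \prod_(i <- s) meval x (F i).
Proof. exact: rmorph_prod. Qed.

Lemma Cbmfun_hol h i j : Cbmfun (fun t => hol t h i j).
Proof.
have centry k l : Cbmfun (fun t => su2_mx (tnth t (enum_rank (hvertex h))) k l).
  have mt : measurable_fun [set: tup] (fun t => tnth t (enum_rank (hvertex h))).
    exact: measurable_tnth.
  exact: (Cbmfun_comp mt (Cbmfun_entry R k l)).
have -> : (fun t => hol t h i j) = (fun t =>
  (psi h i 0 * su2_mx (tnth t (enum_rank (hvertex h))) 0 0
   + psi h i 1 * su2_mx (tnth t (enum_rank (hvertex h))) 1 0) * invmx (psi h) 0 j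
  + (psi h i 0 * su2_mx (tnth t (enum_rank (hvertex h))) 0 1
   + psi h i 1 * su2_mx (tnth t (enum_rank (hvertex h))) 1 1) * invmx (psi h) 1 j).
  by apply/funext => t; rewrite /hol !mulmx_2x2.
by apply: CbmfunD; (apply: CbmfunM; [apply: CbmfunD; apply: CbmfunZ|apply: Cbmfun_cst]).
Qed.

Lemma Cbmfun_hol_z y h : Cbmfun (fun t => hol_z t y h).
Proof. by apply: CbmfunD; apply: CbmfunM; first [exact: Cbmfun_hol|exact: Cbmfun_cst]. Qed.

Lemma Cbmfun_hol_w y h : Cbmfun (fun t => hol_w t y h).
Proof. by apply: CbmfunD; apply: CbmfunM; first [exact: Cbmfun_hol|exact: Cbmfun_cst]. Qed.

Lemma Cbmfun_poly_edge_forms (al be ga de : tup -> edge Gamma -> C) :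
  (forall e, Cbmfun (al^~ e)) -> (forall e, Cbmfun (be^~ e)) ->
  (forall e, Cbmfun (ga^~ e)) -> (forall e, Cbmfun (de^~ e)) ->
  Cbmfun_poly (fun t => \prod_e edge_form le (al t) (be t) (ga t) (de t) e ^+ c e : mpoly nvar C).
Proof.
move=> ca cb cg cd; apply: Cbmfun_poly_prod => e; apply: Cbmfun_polyX.
rewrite /edge_form halves_ofE.
by do !apply: Cbmfun_polyD; apply: Cbmfun_polyZ.
Qed.

Definition edge_mixed_det t e := mixed_det (hol t (e1 e)) (hol t (e2 e)).
Local Notation Eps := (\prod_v epsilon le psi c v : mpoly nvar C).
Local Notation W := (\prod_v vertex_weight v : C).

Lemma prod_by_edge (F : halfedge Gamma -> C) :
  \prod_h F h = \prod_e (F (e1 e) * F (e2 e)).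
Proof.
rewrite (partition_big (@hedge Gamma) xpredT)//=; apply: eq_bigr => e _.
by rewrite (@prod_halves_of _ le C e) halves_ofE big_cons big_seq1.
Qed.

Lemma hedge12 e : hedge (e1 e) = e /\ hedge (e2 e) = e.
Proof.
have [a [b [E ha hb _]]] := halves_ofP le e.
by move: E; rewrite halves_ofE => -[-> ->].
Qed.

(** Contracting in x with y fixed. The two halves of an edge contribute linear
    forms in x_1 and in x_2; their product is a bilinear form of rank one, for
    which [chebU] is a power of tau = omega(A_1 y_1, A_2 y_2). *)
Lemma partial_contraction_integral y : W * contract_edges le c Eps * meval y Eps =
  int (fun t => \prod_e (hol_z t y (e1 e) * hol_w t y (e2 e)
                        - hol_w t y (e1 e) * hol_z t y (e2 e)) ^+ c e).
Proof.
pose al t e := hol_w t y (e1 e) * hol_w t y (e2 e).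
pose be t e := - (hol_w t y (e1 e) * hol_z t y (e2 e)).
pose ga t e := - (hol_z t y (e1 e) * hol_w t y (e2 e)).
pose de t e := hol_z t y (e1 e) * hol_z t y (e2 e).
have cQ : Cbmfun_poly (fun t => \prod_e edge_form le (al t) (be t) (ga t) (de t) e ^+ c e : mpoly nvar C).
  apply: Cbmfun_poly_edge_forms => e; try apply: CbmfunN; apply: CbmfunM;
    first [exact: Cbmfun_hol_z|exact: Cbmfun_hol_w].
have := @Cintegral_linear_form _ _ _ _ (power_measure mu nV) (contract_edges le c)
  ((W * meval y Eps) *: Eps) _ cQ.
rewrite linearZ /= mulrAC => ->.
  congr Cintegral; apply/funext => t; rewrite contract_edge_forms.
  apply: eq_bigr => e _; rewrite (_ : al t e * de t e - be t e * ga t e = 0).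
    by rewrite chebU0; congr (_ ^+ _); rewrite /be /ga; ring.
  by rewrite /al /be /ga /de; ring.
move=> x; rewrite mevalZ.
transitivity (\prod_v (vertex_weight v * (meval x (epsilon le psi c v) * meval y (epsilon le psi c v)))).
  by rewrite !big_split /= -!meval_prod; ring.
rewrite graph_integral; congr Cintegral; apply/funext => t.
rewrite prod_by_edge meval_prod; apply: eq_bigr => e _.
rewrite meval_exp meval_edge_form !halfedge_formE /hcol.
have [-> ->] := hedge12 e.
by rewrite -exprMn; congr (_ ^+ _); rewrite /al /be /ga /de; ring.
Qed.

(** Contracting the remaining variables y. The bilinear form of an edge is now
    omega(A_1 y_1, A_2 y_2), with tau the mixed determinant of A_1 and A_2 and
    with delta = det A_1 det A_2 = 1. *)
Lemma contraction_integral : W * contract_edges le c Eps ^+ 2 =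
  int (fun t => \prod_e chebU (edge_mixed_det t e) 1 (c e)).
Proof.
pose m t e i j := hol t (e1 e) 0 i * hol t (e2 e) 1 j - hol t (e1 e) 1 i * hol t (e2 e) 0 j.
pose al t e := m t e 0 0; pose be t e := m t e 0 1.
pose ga t e := m t e 1 0; pose de t e := m t e 1 1.
have cm e i j : Cbmfun (fun t => m t e i j).
  by apply: CbmfunB; apply: CbmfunM; exact: Cbmfun_hol.
have cQ : Cbmfun_poly (fun t => \prod_e edge_form le (al t) (be t) (ga t) (de t) e ^+ c e : mpoly nvar C).
  by apply: Cbmfun_poly_edge_forms => e; exact: cm.
have := @Cintegral_linear_form _ _ _ _ (power_measure mu nV) (contract_edges le c)
  ((W * contract_edges le c Eps) *: Eps) _ cQ.
rewrite linearZ /= -mulrA -expr2 => ->.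
  congr Cintegral; apply/funext => t; rewrite contract_edge_forms.
  apply: eq_bigr => e _; congr chebU.
    by rewrite /edge_mixed_det /mixed_det /be /ga /m; ring.
  have := det_hol t (e1 e); have := det_hol t (e2 e).
  rewrite !det_2x2 => d2 d1; rewrite -[RHS]mulr1 -{1}d1 -d2 /al /be /ga /de /m; ring.
move=> y; rewrite mevalZ partial_contraction_integral; congr Cintegral; apply/funext => t.
rewrite meval_prod; apply: eq_bigr => e _; rewrite meval_exp meval_edge_form.
by congr (_ ^+ _); rewrite /hol_z /hol_w /al /be /ga /de /m; ring.
Qed.
End Assembly.

Theorem theorem1p2 (R : realType) (Gamma : trivalent_graph)
    (le : rel (halfedge Gamma)) (le_order : half_edge_order le)
    (psi : halfedge Gamma -> 'M[R[i]]_2) (det_psi : forall h, \det (psi h) = 1)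
    (mu : probability (su2 R) R) (haar_mu : is_haar mu)
    (* an orientation: e runs from its half-edge h1 e to its half-edge h2 e *)
    (h1 h2 : edge Gamma -> halfedge Gamma)
    (h1_edge : forall e, hedge (h1 e) = e)
    (h2_edge : forall e, hedge (h2 e) = e)
    (h12_neq : forall e, h1 e != h2 e) :
  Wseries le psi =
  fps_integral (power_measure mu #|vertex Gamma|)
    (fun t : #|vertex Gamma|.-tuple (su2 R) =>
       let g v := su2_mx (tnth t (enum_rank v)) in
       let hol h := psi h *m g (hvertex h) *m invmx (psi h) in
       (\prod_(e : edge Gamma)
          \det (map_mx fpsC (hol (h2 e))
                - Yvar R[i] e *: map_mx fpsC (hol (h1 e))))^-1).
Proof.
have /choice[e1 /choice[e2 eE]] := halves_ofP le.
have halves_ofE e : halves_of le e = [:: e1 e; e2 e] by case: (eE e).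
apply/funext => m; rewrite /fps_integral /Wseries.
set c := fun e => m (enum_rank e).
(* Squaring removes the sign of the crossings; for a coloring that is not
   admissible some vertex has weight 0. *)
transitivity ((\prod_v vertex_weight R le c v) *
    contract_edges le c (\prod_v epsilon le psi c v) ^+ 2 : R[i]).
  case: ifP => [adm|/negbT nadm].
    rewrite /normalized_evaluation evaluation_contraction exprMn sqrr_sign mul1r mulrC; congr (_ * _).
    rewrite -prodfV; apply: eq_bigr => v _.
    have := adm; rewrite (admissibleE le_order) => /forallP/(_ v).
    rewrite /vertex_admissible /vertex_weight.
    by have [h ->] := halves_atP le_order v; rewrite /hcol => ->.
  move: nadm; rewrite (admissibleE le_order) negb_forall => /existsP[v].
  rewrite /vertex_admissible => vn; rewrite (bigD1 v)//= {1}/vertex_weight.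
  have [h E] := halves_atP le_order v; rewrite E in vn *.
  by rewrite /hcol (negbTE vn) !mul0r.
rewrite (contraction_integral le_order det_psi haar_mu c halves_ofE).
congr Cintegral; apply/funext => t.
(* The orientation of e need not be the order of its halves, but the mixed
   determinant is symmetric. *)
have pairC (A B : 'M[R[i]]_2) : mixed_det A B = mixed_det B A by rewrite /mixed_det; ring.
have tauE e : mixed_det (hol psi t (h2 e)) (hol psi t (h1 e)) = edge_mixed_det psi e1 e2 t e.
  have M h : hedge h = e -> h \in [:: e1 e; e2 e].
    by move=> he; rewrite -halves_ofE /halves_of mem_sort mem_enum inE he.
  have := M _ (h1_edge e); have := M _ (h2_edge e); have := h12_neq e.
  rewrite !inE /edge_mixed_det => /[swap]/orP[]/eqP-> /[swap]/orP[]/eqP->; rewrite ?eqxx// => _.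
rewrite -[RHS]/((\prod_(e : edge Gamma)
          \det (map_mx fpsC (hol psi t (h2 e))
                - Yvar R[i] e *: map_mx fpsC (hol psi t (h1 e))))^-1 m).
have detE e : \det (map_mx fpsC (hol psi t (h2 e)) - Yvar R[i] e *: map_mx fpsC (hol psi t (h1 e)))
   = 1 - fpsC (edge_mixed_det psi e1 e2 t e) * fpsX (enum_rank e) + fpsX (enum_rank e) * fpsX (enum_rank e).
  by rewrite det_sub_fps ?tauE//; exact: det_hol.
rewrite (eq_bigr _ (fun e _ => detE e)).
exact: (esym (inv_prod_coef _ _)).
Qed.
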